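(* Let $(M,\pi)$ be a Poisson manifold. The Picard Lie algebra $\mathfrak{pic}(M)$ fits into an exact sequence of Lie algebras $$0\longrightarrow\Omega^1_{\mathrm{cl},\mathrm{bas}}(M)\longrightarrow\Omega^1(M)\longrightarrow\mathfrak g_\pi(M)\longrightarrow\mathfrak{pic}(M)\longrightarrow0,$$ where the first map is the inclusion, the second is $\eta\mapsto(\pi^\sharp(\eta),d\eta)$, and the third is the quotient projection.
   Context: On a Poisson manifold $(M,\pi)$, $\pi^\sharp:T^*M\to TM$ is defined by $\langle\beta,\pi^\sharp\alpha\rangle=\pi(\alpha,\beta)$, and $X_f=\pi^\sharp df$. For a 2-form $\beta$, $\pi^\sharp(\beta)$ is the bivector field $\pi^\sharp(\beta)(\alpha_1,\alpha_2)=\beta(\pi^\sharp\alpha_1,\pi^\sharp\alpha_2)$. $\Omega^1(M)$ is the Lie algebra of 1-forms with the Koszul bracket $[\eta_1,\eta_2]_\pi=\mathcal L_{\pi^\sharp\eta_1}\eta_2-\mathcal L_{\pi^\sharp\eta_2}\eta_1-d(\pi(\eta_1,\eta_2))$. $\Omega^1_{\mathrm{cl},\mathrm{bas}}(M)$ is its subalgebra of closed basic 1-forms, where $\alpha$ is basic if $i_{X_f}\alpha=0$ and $\mathcal L_{X_f}\alpha=0$ for all $f\in C^\infty(M)$. $\mathfrak g_\pi(M)=\{(Z,\beta)\in\mathfrak X(M)\ltimes\Omega^2_{\mathrm{cl}}(M):\mathcal L_Z\pi=\pi^\sharp(\beta)\}$ is a Lie subalgebra of the semidirect product, with bracket $[(Z_1,\beta_1),(Z_2,\beta_2)]=([Z_1,Z_2],\mathcal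 L_{Z_1}\beta_2-\mathcal L_{Z_2}\beta_1)$. $\mathfrak{pic}(M)=\mathfrak g_\pi(M)/\mathfrak I$, where $\mathfrak I=\{(\pi^\sharp(\eta),d\eta):\eta\in\Omega^1(M)\}$, an ideal of $\mathfrak g_\pi(M)$. *)

(* Defs.v *)
From HB Require Import structures.
From mathcomp Require Import all_boot all_order all_algebra.
From mathcomp Require Import all_classical all_reals all_analysis.
From mathcomp Require Import ring.
Import Order.TTheory GRing.Theory Num.Theory numFieldNormedType.Exports.

Set Implicit Arguments.
Unset Strict Implicit.
Unset Printing Implicit Defensive.

Local Open Scope classical_set_scope.
Local Open Scope ring_scope.

Section SmoothOn.
Variables (R : realType) (n : nat).
Implicit Types (U : set 'rV[R]_n) (f g : 'rV[R]_n -> R).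

(* Meant for open U: neither continuity nor derivability is relative to U. *)
Fixpoint Ck_on (k : nat) U f : Prop :=
  (forall x, U x -> {for x, continuous f}) /\
  if k is k'.+1 then
    forall i : 'I_n,
      (forall x, U x -> derivable f x (delta_mx 0 i)) /\
      Ck_on k' U ('D_(delta_mx 0 i) f)
  else True.

Definition smooth_on U f := forall k, Ck_on k U f.

Lemma Ck_on_eq k U f g : open U ->
  (forall x, U x -> f x = g x) -> Ck_on k U f -> Ck_on k U g.
Proof.
move=> oU; elim: k f g => [|k IH] f g fg [cf df].
all: have nfg x : U x -> \forall y \near x, f y = g y by
  move=> Ux; apply: filterS (open_nbhs_nbhs (conj oU Ux)) => y /fg.
all: have cg x : U x -> {for x, continuous g} by
  move=> Ux; rewrite /prop_for /continuous_at -(fg _ Ux);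
  exact: cvg_trans (near_eq_cvg (nfg _ Ux)) (cf _ Ux).
all: split=> // i.
split=> [x Ux|].
  by apply: near_eq_derivable (nfg _ Ux) _; apply: (df i).1.
apply: IH (df i).2 => x Ux.
exact: near_eq_derive (nfg _ Ux).
Qed.

Lemma Ck_on_pred k U f : Ck_on k.+1 U f -> Ck_on k U f.
Proof.
elim: k f => [|k IH] f [cf df]; split=> // i.
by split; [exact: (df i).1|apply: IH; exact: (df i).2].
Qed.

Lemma Ck_on_cst k U (c : R) : open U -> Ck_on k U (cst c).
Proof.
move=> oU; elim: k c => [|k IH] c; split=> //; try by move=> x _; exact: cst_continuous.
move=> i; split=> [x _|]; first exact: derivable_cst.
by apply: Ck_on_eq (IH 0) => // x _; rewrite derive_cst.
Qed.

Lemma Ck_on_lin k U (a : R) f g : open U ->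
  Ck_on k U f -> Ck_on k U g -> Ck_on k U (a *: f + g).
Proof.
move=> oU; elim: k f g => [|k IH] f g [cf df] [cg dg]; split=> //.
1,2: by move=> x Ux; apply: continuousD; [apply: continuousZl_tmp; exact: cf|exact: cg].
move=> i; have [df1 df2] := df i; have [dg1 dg2] := dg i; split=> [x Ux|].
  by apply: derivableD; [apply: derivableZ; exact: df1|exact: dg1].
apply: Ck_on_eq (IH _ _ df2 dg2) => // x Ux.
rewrite deriveD ?deriveZ //; [exact: df1|apply: derivableZ; exact: df1|exact: dg1].
Qed.

Lemma Ck_on_mul k U f g : open U ->
  Ck_on k U f -> Ck_on k U g -> Ck_on k U (f * g).
Proof.
move=> oU; elim: k f g => [|k IH] f g Cf Cg; case: (Cf) => cf df;
  case: (Cg) => cg dg; split=> //.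
1,2: by move=> x Ux; apply: continuousM; [exact: cf|exact: cg].
move=> i; have [df1 df2] := df i; have [dg1 dg2] := dg i; split=> [x Ux|].
  by apply: derivableM; [exact: df1|exact: dg1].
have C1 := IH _ _ (Ck_on_pred Cf) dg2; have C2 := IH _ _ (Ck_on_pred Cg) df2.
apply: Ck_on_eq (Ck_on_lin 1 oU C1 C2) => // x Ux.
by rewrite scale1r deriveM //; [exact: df1|exact: dg1].
Qed.

End SmoothOn.

Record chart (R : realType) (n : nat) (M : topologicalType) := Chart {
  chart_dom : set M;
  chart_map :> M -> 'rV[R]_n;
  chart_inv : 'rV[R]_n -> M;
  chart_dom_open : open chart_dom;
  chart_img_open : open (chart_map @` chart_dom);
  chart_mapK : forall p, chart_dom p -> chart_inv (chart_map p) = p;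
  chart_map_continuous :
    forall p, chart_dom p -> {for p, continuous chart_map};
  chart_inv_continuous :
    forall x, (chart_map @` chart_dom) x -> {for x, continuous chart_inv}
}.

(* The atlas is not required to be maximal: it determines a unique maximal
   one, with the same smooth functions. *)
Record manifold (R : realType) (n : nat) := Manifold {
  mf_sort :> topologicalType;
  mf_hausdorff : hausdorff_space mf_sort;
  mf_second_countable : @second_countable mf_sort;
  atlas : set (chart R n mf_sort);
  atlas_cover : forall p, exists2 c, atlas c & chart_dom c p;
  atlas_compat : forall c d, atlas c -> atlas d -> forall j : 'I_n,
    smooth_on (c @` (chart_dom c `&` chart_dom d))
      (fun x => d (chart_inv c x) 0 j)
}.

Section SmoothFunctions.
Variables (R : realType) (n : nat) (M : manifold R n).

Definition is_smooth (f : M -> R) : Prop :=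
  forall c, atlas c -> smooth_on (c @` chart_dom c) (f \o chart_inv c).

Definition smooth_pred : {pred M -> R} := fun f => `[< is_smooth f >].

Lemma smooth_pred_lin (a : R) f g :
  is_smooth f -> is_smooth g -> is_smooth (a *: f + g).
Proof.
move=> sf sg c Ac k.
have := Ck_on_lin a (@chart_img_open _ _ _ c) (sf c Ac k) (sg c Ac k).
exact.
Qed.

Lemma smooth_pred_cst (a : R) : is_smooth (cst a).
Proof. by move=> c Ac k; have := Ck_on_cst k a (@chart_img_open _ _ _ c); exact. Qed.

Lemma smooth_subring : subring_closed smooth_pred.
Proof.
split=> [|f g|f g]; first by apply/asboolP; exact: (smooth_pred_cst 1).
  move=> /asboolP sf /asboolP sg; apply/asboolP.
  by rewrite addrC -scaleN1r; exact: smooth_pred_lin.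
move=> /asboolP sf /asboolP sg; apply/asboolP => c Ac k.
have := Ck_on_mul (@chart_img_open _ _ _ c) (sf c Ac k) (sg c Ac k); exact.
Qed.
HB.instance Definition _ := GRing.isSubringClosed.Build (M -> R) smooth_pred
  smooth_subring.

Lemma smooth_scale : GRing.scaler_closed smooth_pred.
Proof.
move=> a f /asboolP sf; apply/asboolP.
rewrite -[a *: f]addr0; apply: smooth_pred_lin => //.
exact: (smooth_pred_cst 0).
Qed.
HB.instance Definition _ := GRing.isScaleClosed.Build R (M -> R) smooth_pred
  smooth_scale.

Record smoothFun := SmoothFun {
  smoothFun_val :> M -> R;
  smoothFunP : smoothFun_val \in smooth_pred
}.
HB.instance Definition _ := [isSub for smoothFun_val].
HB.instance Definition _ := [Choice of smoothFun by <:].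
HB.instance Definition _ := GRing.SubChoice_isSubComPzRing.Build (M -> R) smooth_pred smoothFun
  smooth_subring.
HB.instance Definition _ := [SubZmodule_isSubLmodule of smoothFun by <:].

End SmoothFunctions.
Arguments smooth_pred {R n} M f.

Lemma asbool_submod (R : pzRingType) (V : lmodType R) (P : V -> Prop) :
  P 0 -> (forall a u v, P u -> P v -> P (a *: u + v)) ->
  GRing.subsemimod_closed (fun v : V => `[< P v >]).
Proof.
move=> P0 PD; apply: GRing.submod_closed_semi; split; first exact/asboolP.
by move=> a u v /asboolP Pu /asboolP Pv; apply/asboolP; exact: PD.
Qed.

Section VectorFields.
Variables (R : realType) (n : nat) (M : manifold R n).
Local Notation C := (smoothFun M).

Lemma smooth_cst_proof (a : R) : (cst a : M -> R) \in smooth_pred M.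
Proof. by apply/asboolP; exact: smooth_pred_cst. Qed.
Definition smooth_cst (a : R) : C := SmoothFun (smooth_cst_proof a).

Lemma smooth_scaleE (a : R) (f : C) : a *: f = smooth_cst a * f.
Proof. exact: val_inj. Qed.

(* Vector fields and tensor fields are given globally over the ring C^oo(M), as
   in Helgason, Differential Geometry, Lie Groups, and Symmetric Spaces, I.2:
   a vector field is a derivation of C^oo(M), a tensor field is a
   C^oo(M)-multilinear map. On a (Hausdorff, second countable) manifold these
   are the smooth sections of the tensor bundles. *)
Definition is_derivation (D : C -> C) : Prop :=
  (forall (a : R) f g, D (a *: f + g) = a *: D f + D g) /\
  (forall f g, D (f * g) = D f * g + f * D g).

Definition derivation_pred : {pred C -> C} := fun D => `[< is_derivation D >].

Lemma derivation_submod :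
  @GRing.subsemimod_closed R (C -> C) derivation_pred.
Proof.
apply: asbool_submod => [|a D E [Dl DM] [El EM]].
  have z h : (0 : C -> C) h = 0 by [].
  by split=> *; rewrite !z ?smooth_scaleE; ring.
have e h : (a *: D + E) h = a *: D h + E h by [].
by split=> *; rewrite !e ?(Dl, El, DM, EM) !smooth_scaleE; ring.
Qed.
HB.instance Definition _ := GRing.isSubmodClosed.Build R (C -> C)
  derivation_pred derivation_submod.

Record vectorField := VectorField {
  vf_fun :> C -> C;
  vf_funP : vf_fun \in derivation_pred
}.
HB.instance Definition _ := [isSub for vf_fun].
HB.instance Definition _ := [Choice of vectorField by <:].
HB.instance Definition _ := [SubChoice_isSubLmodule of vectorField by <:].


Lemma vfZ (X : vectorField) (a : R) f : X (a *: f) = a *: X f.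
Proof.
have /asboolP[Dl _] := vf_funP X.
by have := Dl a f 0; have := Dl (-1) 0 0; rewrite !scaler0 !addr0 scaleN1r addNr => ->; rewrite addr0.
Qed.

Lemma vfD (X : vectorField) f g : X (f + g) = X f + X g.
Proof. by have /asboolP[Dl _] := vf_funP X; have := Dl 1 f g; rewrite !scale1r. Qed.

Lemma vfN (X : vectorField) f : X (- f) = - X f.
Proof. by rewrite -scaleN1r vfZ scaleN1r. Qed.

Lemma vfM (X : vectorField) f g : X (f * g) = X f * g + f * X g.
Proof. by have /asboolP[_] := vf_funP X. Qed.

Lemma vectorFieldP (X Y : vectorField) : (forall f, X f = Y f) -> X = Y.
Proof. by move=> XY; apply/val_inj/funext. Qed.

Lemma vfDE (X Y : vectorField) f : (X + Y) f = X f + Y f.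
Proof. by []. Qed.

Lemma vfNE (X : vectorField) f : (- X) f = - X f.
Proof. by []. Qed.

Lemma vfZE (a : R) (X : vectorField) f : (a *: X) f = a *: X f.
Proof. by []. Qed.

Lemma vf_scale_proof (h : C) (X : vectorField) :
  (fun f => h * X f) \in derivation_pred.
Proof.
by apply/asboolP; split=> *; rewrite ?vfM ?vfD ?vfZ ?smooth_scaleE; ring.
Qed.
Definition vf_scale h X := VectorField (vf_scale_proof h X).

Lemma vf_bracket_proof (X Y : vectorField) :
  (fun f => X (Y f) - Y (X f)) \in derivation_pred.
Proof.
by apply/asboolP; split=> *;
  rewrite ?(vfM, vfD, vfZ) ?smooth_scaleE; ring.
Qed.
Definition vf_bracket X Y := VectorField (vf_bracket_proof X Y).

Lemma vf_scaleE h X f : vf_scale h X f = h * X f. Proof. by []. Qed.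

Lemma vf_bracketE X Y f : vf_bracket X Y f = X (Y f) - Y (X f).
Proof. by []. Qed.

Lemma vf_scaler_cst (a : R) X : a *: X = vf_scale (smooth_cst a) X.
Proof. by apply: vectorFieldP => f; rewrite vfZE smooth_scaleE. Qed.

End VectorFields.

Section Forms.
Variables (R : realType) (n : nat) (M : manifold R n).
Local Notation C := (smoothFun M).
Local Notation X_M := (vectorField M).
Implicit Types (f g h : C) (X Y Z W : X_M).

Definition is_form1 (eta : X_M -> C) : Prop :=
  forall h X Y, eta (vf_scale h X + Y) = h * eta X + eta Y.

Definition is_form2 (w : X_M -> X_M -> C) : Prop :=
  [/\ forall h X Y Z, w (vf_scale h X + Y) Z = h * w X Z + w Y Z,
      forall h X Y Z, w Z (vf_scale h X + Y) = h * w Z X + w Z Y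
    & forall X, w X X = 0].

Definition form1_pred : {pred X_M -> C} := fun eta => `[< is_form1 eta >].
Definition form2_pred : {pred X_M -> X_M -> C} := fun w => `[< is_form2 w >].

Lemma form1_submod : @GRing.subsemimod_closed R (X_M -> C) form1_pred.
Proof.
apply: asbool_submod => [h X Y|a u v ul vl h X Y].
  have z W : (0 : X_M -> C) W = 0 by [].
  by rewrite !z; ring.
have e W : (a *: u + v) W = a *: u W + v W by [].
by rewrite !e ul vl !smooth_scaleE; ring.
Qed.
HB.instance Definition _ := GRing.isSubmodClosed.Build R (X_M -> C)
  form1_pred form1_submod.

Lemma form2_submod : @GRing.subsemimod_closed R (X_M -> X_M -> C) form2_pred.
Proof.
apply: asbool_submod => [|a u v [ul ur ua] [vl vr va]].
  have z W V : (0 : X_M -> X_M -> C) W V = 0 by [].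
  by split=> *; rewrite !z; ring.
have e W V : (a *: u + v) W V = a *: u W V + v W V by [].
by split=> *; rewrite !e ?(ul, ur, vl, vr, ua, va) !smooth_scaleE; ring.
Qed.
HB.instance Definition _ := GRing.isSubmodClosed.Build R (X_M -> X_M -> C)
  form2_pred form2_submod.

Record form1 := Form1 {
  form1_fun :> X_M -> C;
  form1_funP : form1_fun \in form1_pred
}.
HB.instance Definition _ := [isSub for form1_fun].
HB.instance Definition _ := [Choice of form1 by <:].
HB.instance Definition _ := [SubChoice_isSubLmodule of form1 by <:].

Record form2 := Form2 {
  form2_fun :> X_M -> X_M -> C;
  form2_funP : form2_fun \in form2_pred
}.
HB.instance Definition _ := [isSub for form2_fun].
HB.instance Definition _ := [Choice of form2 by <:].
HB.instance Definition _ := [SubChoice_isSubLmodule of form2 by <:].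

End Forms.

Section CartanCalculus.
Variables (R : realType) (n : nat) (M : manifold R n).
Local Notation C := (smoothFun M).
Implicit Types (f g h : C) (X Y Z W : vectorField M) (eta : form1 M)
  (w : form2 M).

Lemma vf0 X : X 0 = 0.
Proof. by have := vfD X 0 0; rewrite addr0 => /eqP; rewrite -subr_eq subrr => /eqP. Qed.

Lemma form1_lin eta h X Y : eta (vf_scale h X + Y) = h * eta X + eta Y.
Proof. by have /asboolP := form1_funP eta. Qed.

Lemma form1D eta X Y : eta (X + Y) = eta X + eta Y.
Proof.
rewrite -[eta X]mul1r -form1_lin; congr (eta (_ + Y)).
by apply: vectorFieldP => f; rewrite vf_scaleE mul1r.
Qed.

Lemma form10 eta : eta 0 = 0.
Proof. by have := form1D eta 0 0; rewrite addr0 => /eqP; rewrite -subr_eq subrr => /eqP. Qed.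

Lemma form1S eta h X : eta (vf_scale h X) = h * eta X.
Proof. by rewrite -[vf_scale h X]addr0 form1_lin form10 addr0. Qed.

Lemma form1N eta X : eta (- X) = - eta X.
Proof. by apply/eqP; rewrite -addr_eq0 -form1D addNr form10. Qed.

Lemma form2_linl w h X Y Z : w (vf_scale h X + Y) Z = h * w X Z + w Y Z.
Proof. by have /asboolP[] := form2_funP w. Qed.

Lemma form2_linr w h X Y Z : w Z (vf_scale h X + Y) = h * w Z X + w Z Y.
Proof. by have /asboolP[] := form2_funP w. Qed.

Lemma form2_alt w X : w X X = 0.
Proof. by have /asboolP[] := form2_funP w. Qed.

Lemma form2l_proof w Z : (fun X => w X Z) \in @form1_pred R n M.
Proof. by apply/asboolP => h X Y; exact: form2_linl. Qed.
Definition form2l w Z := Form1 (form2l_proof w Z).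

Lemma form2r_proof w Z : (fun X => w Z X) \in @form1_pred R n M.
Proof. by apply/asboolP => h X Y; exact: form2_linr. Qed.
Definition form2r w Z := Form1 (form2r_proof w Z).

Lemma form2Dl w X Y Z : w (X + Y) Z = w X Z + w Y Z.
Proof. exact: (form1D (form2l w Z)). Qed.

Lemma form2Dr w X Y Z : w Z (X + Y) = w Z X + w Z Y.
Proof. exact: (form1D (form2r w Z)). Qed.

Lemma form2Nl w X Z : w (- X) Z = - w X Z.
Proof. exact: (form1N (form2l w Z)). Qed.

Lemma form2Nr w X Z : w Z (- X) = - w Z X.
Proof. exact: (form1N (form2r w Z)). Qed.

Lemma form2Sl w h X Z : w (vf_scale h X) Z = h * w X Z.
Proof. exact: (form1S (form2l w Z)). Qed.

Lemma form2Sr w h X Z : w Z (vf_scale h X) = h * w Z X.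
Proof. exact: (form1S (form2r w Z)). Qed.

Lemma form2C w X Y : w X Y = - w Y X.
Proof.
apply/eqP; rewrite -addr_eq0; apply/eqP.
by have := form2_alt w (X + Y); rewrite form2Dl !form2Dr !form2_alt add0r addr0.
Qed.

Lemma form1P eta (eta' : form1 M) : (forall X, eta X = eta' X) -> eta = eta'.
Proof. by move=> e; apply/val_inj/funext. Qed.

Lemma form2P w (w' : form2 M) : (forall X Y, w X Y = w' X Y) -> w = w'.
Proof. by move=> e; apply/val_inj/funext => X; apply/funext => Y; exact: e. Qed.

Lemma vf_bracketSDr Z h X Y : vf_bracket Z (vf_scale h X + Y) =
  vf_scale h (vf_bracket Z X) + (vf_scale (Z h) X + vf_bracket Z Y).
Proof.
apply: vectorFieldP => f.
by rewrite !(vf_bracketE, vfDE, vf_scaleE, vfD, vfM); ring.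
Qed.

Lemma vf_bracketC X Y : vf_bracket X Y = - vf_bracket Y X.
Proof.
by apply: vectorFieldP => f; rewrite vfNE !vf_bracketE; ring.
Qed.

Lemma vf_bracketXX X : vf_bracket X X = 0.
Proof. by apply: vectorFieldP => f; rewrite vf_bracketE subrr. Qed.

Lemma vf_bracketSDl Z h X Y : vf_bracket (vf_scale h X + Y) Z =
  vf_scale h (vf_bracket X Z) + (- vf_scale (Z h) X + vf_bracket Y Z).
Proof.
apply: vectorFieldP => f.
by rewrite !(vf_bracketE, vfDE, vf_scaleE, vfD, vfM, vfNE); ring.
Qed.

Lemma vf_bracket_jacobi X Y Z : vf_bracket X (vf_bracket Y Z) =
  vf_bracket (vf_bracket X Y) Z + vf_bracket Y (vf_bracket X Z).
Proof.
apply: vectorFieldP => f.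
by rewrite !(vf_bracketE, vfDE, vfD, vfN, vfNE); ring.
Qed.

Lemma f1_scale_proof h eta : (fun X => h * eta X) \in @form1_pred R n M.
Proof. by apply/asboolP => g X Y; cbv beta; rewrite form1_lin; ring. Qed.
Definition f1_scale h eta := Form1 (f1_scale_proof h eta).

Lemma diff0_proof f : (fun X => X f) \in @form1_pred R n M.
Proof. by apply/asboolP => h X Y; cbv beta; rewrite vfDE vf_scaleE. Qed.
Definition diff0 f := Form1 (diff0_proof f).

Lemma lie1_proof Z eta :
  (fun X => Z (eta X) - eta (vf_bracket Z X)) \in @form1_pred R n M.
Proof.
apply/asboolP => h X Y; cbv beta.
by rewrite vf_bracketSDr !(form1_lin, form1D, form1S, vfD, vfM); ring.
Qed.
Definition lie1 Z eta := Form1 (lie1_proof Z eta).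

Lemma lie2_proof Z w :
  (fun X Y => Z (w X Y) - w (vf_bracket Z X) Y - w X (vf_bracket Z Y))
    \in @form2_pred R n M.
Proof.
apply/asboolP; split=> [h X Y W|h X Y W|X]; cbv beta.
- rewrite !vf_bracketSDr !(form2_linl, form2Dl, form2Sl, vfD, vfM); ring.
- by rewrite !vf_bracketSDr !(form2_linr, form2Dr, form2Sr, vfD, vfM); ring.
by rewrite form2_alt vf0 (form2C w X); ring.
Qed.
Definition lie2 Z w := Form2 (lie2_proof Z w).

(* The exterior derivative is normalised without the factors 1/(k+1). *)
Lemma diff1_proof eta :
  (fun X Y => X (eta Y) - Y (eta X) - eta (vf_bracket X Y))
    \in @form2_pred R n M.
Proof.
apply/asboolP; split=> [h X Y W|h X Y W|X]; cbv beta.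
- rewrite vf_bracketSDl.
  by rewrite !(form1_lin, form1D, form1S, form1N, vfDE, vf_scaleE, vfD, vfM); ring.
- rewrite vf_bracketSDr.
  by rewrite !(form1_lin, form1D, form1S, vfDE, vf_scaleE, vfD, vfM); ring.
by rewrite subrr vf_bracketXX form10 subr0.
Qed.
Definition diff1 eta := Form2 (diff1_proof eta).

Definition diff2 w X Y Z : C :=
  X (w Y Z) - Y (w X Z) + Z (w X Y)
  - w (vf_bracket X Y) Z + w (vf_bracket X Z) Y - w (vf_bracket Y Z) X.

Definition closed1 eta : Prop := diff1 eta = 0.
Definition closed2 w : Prop := forall X Y Z, diff2 w X Y Z = 0.

Definition closed2_pred : {pred form2 M} := fun w => `[< closed2 w >].

Lemma closed2_submod : @GRing.subsemimod_closed R (form2 M) closed2_pred.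
Proof.
apply: asbool_submod => [|a u v cu cv] X Y Z.
  have z U V : (0 : form2 M) U V = 0 by [].
  by rewrite /diff2 !z !vf0; ring.
have e U V : (a *: u + v) U V = a *: u U V + v U V by [].
transitivity (a *: diff2 u X Y Z + diff2 v X Y Z); last first.
  by rewrite cu cv scaler0 addr0.
by rewrite /diff2 !e !vfD !vfZ !smooth_scaleE; ring.
Qed.
HB.instance Definition _ := GRing.isSubmodClosed.Build R (form2 M)
  closed2_pred closed2_submod.

Record cform2 := CForm2 {
  cform2_val :> form2 M;
  cform2P : cform2_val \in closed2_pred
}.
HB.instance Definition _ := [isSub for cform2_val].
HB.instance Definition _ := [Choice of cform2 by <:].
HB.instance Definition _ := [SubChoice_isSubLmodule of cform2 by <:].

Lemma diff1E eta X Y :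
  diff1 eta X Y = X (eta Y) - Y (eta X) - eta (vf_bracket X Y).
Proof. by []. Qed.

Lemma lie1E Z eta X : lie1 Z eta X = Z (eta X) - eta (vf_bracket Z X).
Proof. by []. Qed.

Lemma lie2E Z w X Y :
  lie2 Z w X Y = Z (w X Y) - w (vf_bracket Z X) Y - w X (vf_bracket Z Y).
Proof. by []. Qed.

Lemma diff1_closed eta : diff1 eta \in closed2_pred.
Proof.
apply/asboolP => X Y Z; rewrite /diff2 !diff1E.
rewrite (vf_bracketC (vf_bracket Y Z) X) (vf_bracket_jacobi X Y Z).
rewrite (vf_bracketC (vf_bracket X Z) Y).
by rewrite !(vfD, vfN, vf_bracketE, form1N, form1D); ring.
Qed.
Definition diff1c eta : cform2 := CForm2 (diff1_closed eta).

Lemma lie2_closed Z (b : cform2) : lie2 Z b \in closed2_pred.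
Proof.
have /asboolP cw := cform2P b.
apply/asboolP => X Y W.
transitivity (Z (diff2 b X Y W) - diff2 b (vf_bracket Z X) Y W
  - diff2 b X (vf_bracket Z Y) W - diff2 b X Y (vf_bracket Z W)); last first.
  by rewrite !cw vf0 !subr0.
rewrite /diff2 !lie2E !(vf_bracket_jacobi Z) !form2Dl.
by rewrite !(vfD, vfN, vf_bracketE); ring.
Qed.
Definition lie2c Z b : cform2 := CForm2 (lie2_closed Z b).

End CartanCalculus.

Section LieAlgebras.
Variable R : pzRingType.

Record is_lie_bracket (V : lmodType R) (br : V -> V -> V) : Prop :=
  IsLieBracket {
    lie_linl : forall a x y z, br (a *: x + y) z = a *: br x z + br y z;
    lie_linr : forall a x y z, br z (a *: x + y) = a *: br z x + br z y;
    lie_alt : forall x, br x x = 0;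
    lie_jacobi : forall x y z,
      br x (br y z) + br y (br z x) + br z (br x y) = 0
  }.

Record lieAlgebra := LieAlgebra {
  lie_sort :> lmodType R;
  lie_br : lie_sort -> lie_sort -> lie_sort;
  lieP : is_lie_bracket lie_br
}.

Definition is_subspace (V : lmodType R) (S : set V) : Prop :=
  S 0 /\ forall a x y, S x -> S y -> S (a *: x + y).

Definition lie_subalgebra (L : lieAlgebra) (S : set L) : Prop :=
  is_subspace S /\ forall x y, S x -> S y -> S (lie_br x y).

Definition lie_ideal (L : lieAlgebra) (I : set L) : Prop :=
  is_subspace I /\ forall x y, I y -> I (lie_br x y).

Definition lie_hom (L L' : lieAlgebra) (f : L -> L') : Prop :=
  (forall a x y, f (a *: x + y) = a *: f x + f y) /\
  (forall x y, f (lie_br x y) = lie_br (f x) (f y)).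

(* 0 -> A -f-> B -g-> C -h-> D -> 0 is exact. *)
Definition lie_exact (A B C D : lieAlgebra)
    (f : A -> B) (g : B -> C) (h : C -> D) : Prop :=
  [/\ lie_hom f, lie_hom g & lie_hom h] /\
  [/\ injective f,
      range f = [set x | g x = 0],
      range g = [set x | h x = 0]
    & range h = setT].

Section Sub.
Variables (L : lieAlgebra) (S : set L) (hS : lie_subalgebra S).

Definition sub_lie_pred (_ : lie_subalgebra S) : {pred L} := fun x => `[< S x >].

Lemma sub_lie_submod : GRing.subsemimod_closed (sub_lie_pred hS).
Proof. by have [[S0 SD] _] := hS; exact: asbool_submod. Qed.
HB.instance Definition _ := GRing.isSubmodClosed.Build R L
  (sub_lie_pred hS) sub_lie_submod.

Record sub_lie_type := SubLie {
  sub_lie_val : L;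
  sub_lie_valP : sub_lie_val \in sub_lie_pred hS
}.
HB.instance Definition _ := [isSub for sub_lie_val].
HB.instance Definition _ := [Choice of sub_lie_type by <:].
HB.instance Definition _ := [SubChoice_isSubLmodule of sub_lie_type by <:].

Lemma sub_lie_br_proof (x y : sub_lie_type) :
  lie_br (sub_lie_val x) (sub_lie_val y) \in sub_lie_pred hS.
Proof.
have [_ SB] := hS; case: x y => [x xP] [y yP] /=.
by apply/asboolP/SB; apply/asboolP.
Qed.
Definition sub_lie_br x y := SubLie (sub_lie_br_proof x y).

Lemma sub_lie_brP : is_lie_bracket sub_lie_br.
Proof.
have [bl br ba bj] := lieP L.
by split=> *; apply: val_inj; [exact: bl|exact: br|exact: ba|exact: bj].
Qed.

Definition sub_lie : lieAlgebra := LieAlgebra sub_lie_brP.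

End Sub.

Section Quotient.
Variables (L : lieAlgebra) (I : set L) (hI : lie_ideal I).
Local Open Scope quotient_scope.

Definition ideal_pred (_ : lie_ideal I) : {pred L} := fun x => `[< I x >].

Lemma ideal_submod : GRing.subsemimod_closed (ideal_pred hI).
Proof. by have [[I0 ID] _] := hI; exact: asbool_submod. Qed.
HB.instance Definition _ := GRing.isSubmodClosed.Build R L
  (ideal_pred hI) ideal_submod.

Definition quot_lie_type : Type := Quotient.quot (ideal_pred hI).
HB.instance Definition _ := Choice.on quot_lie_type.
HB.instance Definition _ := GRing.Zmodule.on quot_lie_type.

Definition quot_lie_proj (x : L) : quot_lie_type :=
  \pi_(Quotient.quot (ideal_pred hI)) x.

Lemma quot_lie_projP x y : quot_lie_proj x = quot_lie_proj y <-> I (x - y).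
Proof.
split=> [/eqP|Ixy].
  by rewrite -Quotient.idealrBE => /asboolP.
by apply/eqP; rewrite -Quotient.idealrBE; apply/asboolP.
Qed.

Lemma quot_lie_projK x : quot_lie_proj (repr x) = x.
Proof. exact: reprK. Qed.

Lemma quot_lie_projD x y :
  quot_lie_proj (x + y) = quot_lie_proj x + quot_lie_proj y.
Proof. exact: raddfD. Qed.

Lemma quot_lie_reprP (x : L) : I (repr (quot_lie_proj x) - x).
Proof. by apply/quot_lie_projP; rewrite quot_lie_projK. Qed.

Definition quot_lie_scale (a : R) (x : quot_lie_type) : quot_lie_type :=
  quot_lie_proj (a *: repr x).

Lemma quot_lie_scaleE a x :
  quot_lie_scale a (quot_lie_proj x) = quot_lie_proj (a *: x).
Proof.
have [[I0 ID] _] := hI; apply/quot_lie_projP.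
rewrite -scalerBr -[X in I X]addr0; apply: ID => //; exact: quot_lie_reprP.
Qed.

Lemma quot_lie_scalerA a b x :
  quot_lie_scale a (quot_lie_scale b x) = quot_lie_scale (a * b) x.
Proof. by rewrite -[x]quot_lie_projK !quot_lie_scaleE scalerA. Qed.

Lemma quot_lie_scale1r : left_id 1 quot_lie_scale.
Proof. by move=> x; rewrite -[x]quot_lie_projK quot_lie_scaleE scale1r. Qed.

Lemma quot_lie_scalerDr : right_distributive quot_lie_scale +%R.
Proof.
move=> a x y; rewrite -[x]quot_lie_projK -[y]quot_lie_projK.
by rewrite -quot_lie_projD !quot_lie_scaleE scalerDr quot_lie_projD.
Qed.

Lemma quot_lie_scalerDl x : {morph quot_lie_scale^~ x : a b / a + b}.
Proof.
move=> a b; rewrite -[x]quot_lie_projK !quot_lie_scaleE.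
by rewrite scalerDl quot_lie_projD.
Qed.

HB.instance Definition _ := GRing.Zmodule_isLmodule.Build R quot_lie_type
  quot_lie_scalerA quot_lie_scale1r quot_lie_scalerDr quot_lie_scalerDl.

Definition quot_lie_br (x y : quot_lie_type) : quot_lie_type :=
  quot_lie_proj (lie_br (repr x) (repr y)).

Lemma lie_brDl (x y z : L) : lie_br (x + y) z = lie_br x z + lie_br y z.
Proof. by have := lie_linl (lieP L) 1 x y z; rewrite !scale1r. Qed.

Lemma lie_brDr (x y z : L) : lie_br z (x + y) = lie_br z x + lie_br z y.
Proof. by have := lie_linr (lieP L) 1 x y z; rewrite !scale1r. Qed.

Lemma lie_brC (x y : L) : lie_br x y = - lie_br y x.
Proof.
apply/eqP; rewrite -addr_eq0; apply/eqP.
have alt := lie_alt (lieP L).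
by have := alt (x + y); rewrite lie_brDl !lie_brDr !alt add0r addr0.
Qed.

Lemma quot_lie_brE (x y : L) :
  quot_lie_br (quot_lie_proj x) (quot_lie_proj y) = quot_lie_proj (lie_br x y).
Proof.
have [[I0 ID] IB] := hI.
have IBl u v : I u -> I (lie_br u v).
  by move=> Iu; rewrite lie_brC -scaleN1r -[X in I X]addr0; apply: ID => //; exact: IB.
apply/quot_lie_projP.
set x' := repr _; set y' := repr _.
have -> : x' = (x' - x) + x by rewrite subrK.
have -> : lie_br (x' - x + x) y' - lie_br x y =
    1 *: lie_br (x' - x) y' + lie_br x (y' - y).
  rewrite scale1r lie_brDl -addrA; congr (_ + _).
  by apply/eqP; rewrite subr_eq -lie_brDr subrK.
by apply: ID; [apply: IBl|apply: IB]; exact: quot_lie_reprP.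
Qed.

Lemma quot_lie_projZ a x : quot_lie_proj (a *: x) = a *: quot_lie_proj x.
Proof. by rewrite -quot_lie_scaleE. Qed.

Lemma quot_lie_brP : is_lie_bracket quot_lie_br.
Proof.
have [bl br ba bj] := lieP L.
have quotW (P : quot_lie_type -> Prop) :
  (forall u, P (quot_lie_proj u)) -> forall x, P x.
  by move=> h x; rewrite -(quot_lie_projK x).
split=> [a|a||].
- elim/quotW=> x; elim/quotW=> y; elim/quotW=> z.
  by rewrite -quot_lie_projZ -quot_lie_projD !quot_lie_brE bl quot_lie_projD
    quot_lie_projZ.
- elim/quotW=> x; elim/quotW=> y; elim/quotW=> z.
  by rewrite -quot_lie_projZ -quot_lie_projD !quot_lie_brE br quot_lie_projD
    quot_lie_projZ.
- by elim/quotW=> x; rewrite quot_lie_brE ba; exact: raddf0.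
elim/quotW=> x; elim/quotW=> y; elim/quotW=> z.
by rewrite !quot_lie_brE -!quot_lie_projD bj; exact: raddf0.
Qed.

Definition quot_lie : lieAlgebra := LieAlgebra quot_lie_brP.

End Quotient.

End LieAlgebras.

Section Semidirect.
Variables (R : realType) (n : nat) (M : manifold R n).

Definition semidirect_br (u v : vectorField M * cform2 M) :
    vectorField M * cform2 M :=
  (vf_bracket u.1 v.1, lie2c u.1 v.2 - lie2c v.1 u.2).

Lemma cform2_eq (b c : cform2 M) : (forall X Y, b X Y = c X Y) -> b = c.
Proof. by move=> e; apply/val_inj/form2P. Qed.

Lemma cform2DE (b c : cform2 M) X Y : (b + c) X Y = b X Y + c X Y.
Proof. by []. Qed.

Lemma cform2NE (b : cform2 M) X Y : (- b) X Y = - b X Y.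
Proof. by []. Qed.

Lemma cform2ZE (a : R) (b : cform2 M) X Y : (a *: b) X Y = a *: b X Y.
Proof. by []. Qed.

Lemma lie2cE Z (b : cform2 M) X Y : lie2c Z b X Y =
  Z (b X Y) - b (vf_bracket Z X) Y - b X (vf_bracket Z Y).
Proof. by []. Qed.

Lemma vf_bracket_linl (a : R) (X Y Z : vectorField M) :
  vf_bracket (a *: X + Y) Z = a *: vf_bracket X Z + vf_bracket Y Z.
Proof.
apply: vectorFieldP => f.
by rewrite !(vfDE, vfZE, vf_bracketE, vfD, vfZ, smooth_scaleE); ring.
Qed.

Lemma vf_bracket_linr (a : R) (X Y Z : vectorField M) :
  vf_bracket Z (a *: X + Y) = a *: vf_bracket Z X + vf_bracket Z Y.
Proof.
apply: vectorFieldP => f.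
by rewrite !(vfDE, vfZE, vf_bracketE, vfD, vfZ, smooth_scaleE); ring.
Qed.

Lemma lie2c_linl (a : R) (X Y : vectorField M) b :
  lie2c (a *: X + Y) b = a *: lie2c X b + lie2c Y b.
Proof.
apply: cform2_eq => V W; rewrite cform2DE cform2ZE !lie2cE !vf_bracket_linl.
rewrite !vf_scaler_cst !form2_linl !form2_linr !(vfDE, vf_scaleE) smooth_scaleE.
by ring.
Qed.

Lemma lie2c_linr (a : R) (X : vectorField M) b c :
  lie2c X (a *: b + c) = a *: lie2c X b + lie2c X c.
Proof.
apply: cform2_eq => V W.
by rewrite !(cform2DE, cform2ZE, lie2cE) vfD vfZ !smooth_scaleE; ring.
Qed.

Lemma lie2c_bracket (X Y : vectorField M) b :
  lie2c (vf_bracket X Y) b = lie2c X (lie2c Y b) - lie2c Y (lie2c X b).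
Proof.
apply: cform2_eq => V W; rewrite !(cform2DE, cform2NE) !lie2cE.
rewrite !(vf_bracket_jacobi X Y) !form2Dl !form2Dr !(vf_bracketE, vfD, vfN).
by ring.
Qed.

Lemma semidirect_brP : is_lie_bracket (V := (vectorField M * cform2 M)%type)
  semidirect_br.
Proof.
rewrite /semidirect_br; split=> [a x y z|a x y z|x|x y z].
- congr (_, _) => /=; first exact: vf_bracket_linl.
  by rewrite lie2c_linl lie2c_linr scalerBr opprD addrACA.
- congr (_, _) => /=; first exact: vf_bracket_linr.
  by rewrite lie2c_linl lie2c_linr scalerBr opprD addrACA.
- by rewrite vf_bracketXX subrr.
have lB (X : vectorField M) b c : lie2c X (b - c) = lie2c X b - lie2c X c.
  by have := lie2c_linr (-1) X c b; rewrite !scaleN1r ![- _ + _]addrC.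
congr (_, _) => /=.
  apply: vectorFieldP => f; have -> : (0 : vectorField M) f = 0 by [].
  by rewrite !(vfDE, vf_bracketE, vfD, vfN); ring.
apply: cform2_eq => V W; have -> : (0 : cform2 M) V W = 0 by [].
by rewrite !lie2c_bracket !lB !(cform2DE, cform2NE); ring.
Qed.

Definition semidirect : lieAlgebra R := LieAlgebra semidirect_brP.

End Semidirect.

Section Poisson.
Variables (R : realType) (n : nat) (M : manifold R n).
Local Notation C := (smoothFun M).

Record bivector := Bivector {
  biv_fun :> form1 M -> form1 M -> C;
  biv_linl : forall h a b c,
    biv_fun (f1_scale h a + b) c = h * biv_fun a c + biv_fun b c;
  biv_linr : forall h a b c,
    biv_fun c (f1_scale h a + b) = h * biv_fun c a + biv_fun c b;
  biv_alt : forall a, biv_fun a a = 0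
}.

Definition poisson_br (pi : bivector) (f g : C) : C := pi (diff0 f) (diff0 g).

Record poissonStructure := PoissonStructure {
  poisson_biv :> bivector;
  poisson_jacobi : forall f g h,
    poisson_br poisson_biv f (poisson_br poisson_biv g h) +
    poisson_br poisson_biv g (poisson_br poisson_biv h f) +
    poisson_br poisson_biv h (poisson_br poisson_biv f g) = 0
}.

Variable pi : poissonStructure.

(* pi^# alpha is the unique X such that <beta, X> = pi(alpha, beta) for all
   beta; it always exists on a manifold, so the default value 0 is not used. *)
Definition sharp (alpha : form1 M) : vectorField M :=
  xget 0 [set X | forall beta : form1 M, beta X = pi alpha beta].

Definition ham (f : C) : vectorField M := sharp (diff0 f).

(* The bivector field pi^#(beta) of a 2-form beta. *)
Definition sharp2 (beta : form2 M) (a1 a2 : form1 M) : C :=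
  beta (sharp a1) (sharp a2).

Definition lie_biv (Z : vectorField M) (a1 a2 : form1 M) : C :=
  Z (pi a1 a2) - pi (lie1 Z a1) a2 - pi a1 (lie1 Z a2).

Definition koszul_br (e1 e2 : form1 M) : form1 M :=
  lie1 (sharp e1) e2 - lie1 (sharp e2) e1 - diff0 (pi e1 e2).

Definition is_basic (a : form1 M) : Prop :=
  forall f, a (ham f) = 0 /\ lie1 (ham f) a = 0.

Definition closed_basic : set (form1 M) :=
  [set a | closed1 a /\ is_basic a].

Definition g_pi : set (semidirect M) :=
  [set u : vectorField M * cform2 M | lie_biv u.1 = sharp2 u.2].

Definition anchor_diff (eta : form1 M) : semidirect M :=
  (sharp eta, diff1c eta).

Definition pic_ideal (hG : lie_subalgebra g_pi) : set (sub_lie hG) :=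
  [set u | exists eta, sub_lie_val u = anchor_diff eta].

End Poisson.
Arguments pic_ideal {R n M pi} hG _.

(* The Lie algebras of the exact sequence. That the Koszul bracket is a Lie
   bracket, that the subspaces below are subalgebras, and that pic_ideal is an
   ideal all depend on the Jacobi identity for pi; these facts enter as
   parameters hO, hB, hG and hI. *)
Section PicardLieAlgebra.
Variables (R : realType) (n : nat) (M : manifold R n).
Variable pi : poissonStructure M.

Definition Omega1 (hO : is_lie_bracket (koszul_br pi)) : lieAlgebra R :=
  LieAlgebra hO.

Definition Omega1_clbas (hO : is_lie_bracket (koszul_br pi))
    (hB : @lie_subalgebra R (Omega1 hO) (closed_basic pi)) : lieAlgebra R :=
  sub_lie hB.

Definition g_lie (hG : lie_subalgebra (g_pi pi)) : lieAlgebra R := sub_lie hG.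

Definition pic (hG : lie_subalgebra (g_pi pi))
    (hI : @lie_ideal R (g_lie hG) (pic_ideal hG)) : lieAlgebra R :=
  quot_lie hI.

Definition clbas_incl (hO : is_lie_bracket (koszul_br pi))
    (hB : @lie_subalgebra R (Omega1 hO) (closed_basic pi)) :
    Omega1_clbas hB -> Omega1 hO :=
  fun a => sub_lie_val a.

Definition Omega1_to_g (hO : is_lie_bracket (koszul_br pi))
    (hG : lie_subalgebra (g_pi pi))
    (hA : forall eta, g_pi pi (anchor_diff pi eta)) :
    Omega1 hO -> g_lie hG :=
  fun eta => @SubLie R _ _ hG (anchor_diff pi eta) (asboolT (hA eta)).

Definition pic_proj (hG : lie_subalgebra (g_pi pi))
    (hI : @lie_ideal R (g_lie hG) (pic_ideal hG)) : g_lie hG -> pic hI :=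
  fun u => quot_lie_proj hI u.

End PicardLieAlgebra.

(* Main.v *)
(* The algebra rests on one geometric fact: on a manifold, a C^oo(M)-linear map
   on 1-forms that vanishes on all exact forms is zero ([vanish_on_exact]).
   By Hadamard's lemma f - f(q) = sum_j (x_j - q_j) g_j in a chart, so near
   each point every derivation is a combination of the d/dx_j cut off by a bump
   function; hence a cut-off 1-form is a combination of exact forms. This makes
   pi^# well defined, and reduces to exact forms, where they are the Jacobi
   identity of the Poisson bracket, both pi^#[a,b] = [pi^# a, pi^# b] and the
   Jacobi identity of the Koszul bracket. The kernel of a |-> (pi^# a, da) is
   identified with the closed basic forms because a(X_f) = - df(pi^# a) and
   L_X a = d(i_X a) for closed a. Finally, for (Z, beta) in g_pi,
   [Z, pi^# a] = pi^#(L_Z a - i_{pi^# a} beta), which shows that g_pi is closed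
   under brackets and that the image of Omega^1 is an ideal. *)
Require Import Defs.
From HB Require Import structures.
From mathcomp Require Import all_boot all_order all_algebra.
From mathcomp Require Import all_classical all_reals all_analysis.
From mathcomp Require Import ring lra.
Import Order.TTheory GRing.Theory Num.Theory numFieldNormedType.Exports.

Set Implicit Arguments.
Unset Strict Implicit.
Unset Printing Implicit Defensive.

Local Open Scope classical_set_scope.
Local Open Scope ring_scope.

(** * Calculus on R^n *)

Section MultivariateCalculus.
Variables (R : realType) (n : nat).
Implicit Types (F : 'rV[R]_n -> R) (x v : 'rV[R]_n).
Local Notation e_ j := (delta_mx 0 j : 'rV[R]_n).

(** Restricting [F] to a line leaves the difference quotient in direction [v] literally unchanged,
    so one-variable calculus transfers to directional derivatives in both directions. *)
Lemma line_quotient F x v (t : R) :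
  (fun h : R => h^-1 *: (((fun s => F (x + s *: v)) \o shift t) (h *: 1)
      - F (x + t *: v))) =
  (fun h => h^-1 *: ((F \o shift (x + t *: v)) (h *: v) - F (x + t *: v))).
Proof.
apply/funext => h /=; congr (_ *: (F _ - _)).
by rewrite /= [h *: 1]mulr1 scalerDl addrCA.
Qed.

Lemma is_derive_line F x v (t : R) : derivable F (x + t *: v) v ->
  is_derive t 1 (fun s => F (x + s *: v)) ('D_v F (x + t *: v)).
Proof. by move=> d; split; rewrite /derivable /derive line_quotient. Qed.

Lemma is_derive_of_line F x v (d : R) :
  is_derive (0 : R) 1 (fun s => F (x + s *: v)) d -> is_derive x v F d.
Proof.
case; rewrite /derivable /derive line_quotient scale0r addr0 => dF <-.
exact: DeriveDef.
Qed.

(** The absolute values allow either sign of [s]: the mean value theorem is applied on [[0, s]] or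
    on [[s, 0]]. *)
Lemma line_MVT F x v (s : R) :
  (forall t : R, `|t| <= `|s| -> derivable F (x + t *: v) v) ->
  exists2 c, `|c| <= `|s| & F (x + s *: v) - F x = s * 'D_v F (x + c *: v).
Proof.
move=> dF; pose g (t : R) : R := F (x + t *: v); pose dg (t : R) : R := 'D_v F (x + t *: v).
have dgP (t : R) : `|t| <= `|s| -> is_derive t 1 g (dg t).
  by move=> /dF; exact: is_derive_line.
have g0 : g 0 = F x by rewrite /g scale0r addr0.
rewrite -g0 -/(g s).
have [s0|s0] := leP 0 s.
  have sub t : t \in `[0, s] -> `|t| <= `|s|.
    by rewrite in_itv/= => /andP[t0 ts]; rewrite !ger0_norm.
  have [//|||c /sub ? ->] := @MVT_segment R g dg 0 s.
  - by move=> t /subset_itv_oo_cc /sub; exact: dgP.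
  - by apply: derivable_within_continuous => t /sub/dgP[].
  by exists c => //; rewrite subr0 mulrC.
have sub t : t \in `[s, 0] -> `|t| <= `|s|.
  by rewrite in_itv/= => /andP[t0 ts]; rewrite !ler0_norm ?lerN2// ltW.
have [|||c /sub ? E] := @MVT_segment R g dg s 0.
- exact: ltW.
- by move=> t /subset_itv_oo_cc /sub; exact: dgP.
- by apply: derivable_within_continuous => t /sub/dgP[].
exists c => //; rewrite -/(dg c); apply: oppr_inj; rewrite opprB E; ring.
Qed.

Lemma coord_le_norm v j : `|v 0 j| <= `|v|.
Proof.
rewrite [`|v|]mx_normrE; exact: (@le_bigmax _ _ _ 0 (fun ij => `|v ij.1 ij.2|) (0, j)).
Qed.

Lemma norm_le_coord v (r : R) : 0 <= r -> (forall j, `|v 0 j| <= r) -> `|v| <= r.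
Proof.
move=> r0 vr; rewrite [`|v|]mx_normrE; apply/bigmax_leP; split=> // -[i j] _ /=.
by rewrite ord1.
Qed.

Lemma delta_coord (i j : 'I_n) : (e_ i) 0 j = (j == i)%:R.
Proof. by rewrite mxE eqxx. Qed.

Definition lincomb (a : 'I_n -> R) v : R := \sum_j v 0 j * a j.

Lemma lincomb_linear a : linear (lincomb a).
Proof.
move=> k u v; rewrite /lincomb scaler_sumr -big_split; apply: eq_bigr => j _ /=.
by rewrite !mxE mulrDl -mulrA.
Qed.
HB.instance Definition _ a :=
  GRing.isLinear.Build R 'rV[R]_n R *:%R (lincomb a) (lincomb_linear a).

Lemma lincomb_continuous a : continuous (lincomb a).
Proof.
have -> : lincomb a = \sum_j (fun v => v 0 j * a j).
  by apply/funext => v; rewrite fct_sumE.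
elim/big_ind: _ => [|f g cf cg v|j _ v]; first exact: (@cst_continuous _ _ (0 : R)).
  exact: continuousD (cf v) (cg v).
apply: (@continuousM _ _ (fun v : 'rV[R]_n => v 0 j) (cst (a j))).
  exact: coord_continuous.
exact: cst_continuous.
Qed.

Lemma derive_coord v j x : 'D_v (fun u : 'rV[R]_n => u 0 j) x = v 0 j.
Proof.
apply/lim_near_cst => //.
apply/nbhs_ballP; exists 1 => //= h _ h0 /=.
by rewrite !mxE addrK; exact: mulKf.
Qed.

(** The points [x + prefix v k] are the corners of a path from [x] to [x + v] that changes one
    coordinate at a time. *)
Definition prefix v (k : nat) : 'rV[R]_n := \row_j (if (j < k)%N then v 0 j else 0).

Lemma prefixS v (j : 'I_n) : prefix v j.+1 = prefix v j + v 0 j *: e_ j.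
Proof.
apply/rowP => i; rewrite !mxE eqxx /= ltnS leq_eqVlt.
case: (eqVneq i j) => [->|ij]; first by rewrite eqxx ltnn mulr1 add0r.
by rewrite -val_eqE /= in ij; rewrite (negbTE ij) mulr0 addr0.
Qed.

Lemma increment_prefix F x v : F (x + v) - F x =
  \sum_(j < n) (F (x + prefix v j + v 0 j *: e_ j) - F (x + prefix v j)).
Proof.
have p0 : prefix v 0 = 0 by apply/rowP => i; rewrite !mxE.
have pn : prefix v n = v by apply/rowP => i; rewrite !mxE ltn_ord.
under eq_bigr do rewrite -addrA -prefixS.
rewrite -(big_mkord xpredT (fun j => F (x + prefix v j.+1) - F (x + prefix v j))).
by rewrite telescope_sumr// p0 pn addr0.
Qed.

(** The mean value theorem holds on each axis-parallel leg of the path. In the sup norm no point of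
    the path is further than [|v|] from [x]. *)
Lemma increment_MVT F x v :
  (forall y j, `|y - x| <= `|v| -> derivable F y (e_ j)) ->
  exists2 z : 'I_n -> 'rV[R]_n, forall j, `|z j - x| <= `|v| &
    F (x + v) - F x = \sum_j v 0 j * 'D_(e_ j) F (z j).
Proof.
move=> dF.
have near_x (j : 'I_n) t : `|t| <= `|v 0 j| -> `|x + prefix v j + t *: e_ j - x| <= `|v|.
  move=> tv; rewrite -[x + _ + _]addrA [x + _]addrC addrK; apply: norm_le_coord => // i.
  rewrite !mxE eqxx /=; case: ifPn => [ij|_]; last first.
    rewrite add0r; case: eqP => _; last by rewrite mulr0 normr0.
    by rewrite mulr1 (le_trans tv)// coord_le_norm.
  by rewrite -val_eqE ltn_eqF// mulr0 addr0 coord_le_norm.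
have M (j : 'I_n) : exists z, `|z - x| <= `|v| /\
    F (x + prefix v j + v 0 j *: e_ j) - F (x + prefix v j) = v 0 j * 'D_(e_ j) F z.
  have [t tv|c cv ->] := @line_MVT F (x + prefix v j) (e_ j) (v 0 j).
    by apply: dF; exact: near_x.
  by exists (x + prefix v j + c *: e_ j); split=> //; exact: near_x.
have [z zP] := choice M; exists z => [j|]; first exact: (zP j).1.
by rewrite increment_prefix; apply: eq_bigr => j _; exact: (zP j).2.
Qed.

(** By [increment_MVT] the error is a sum of terms [v_j] times a difference of values of one partial
    derivative at two nearby points, which continuity makes small. *)
Lemma C1_diff_littleo F x :
  (\forall y \near x, forall j, derivable F y (e_ j)) ->
  (forall j, {for x, continuous ('D_(e_ j) F)}) ->
  forall e : R, 0 < e -> \forall v \near (0 : 'rV[R]_n),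
    `|F (v + x) - (F x + lincomb (fun j => 'D_(e_ j) F x) v)| <= e * `|v|.
Proof.
move=> dF cF e e0.
(* There are [n] error terms; dividing by [n + 1] also covers [n = 0]. *)
pose e' := e / n.+1%:R; have e'0 : 0 < e' by rewrite divr_gt0.
have cFj j : \forall y \near x, `|'D_(e_ j) F x - 'D_(e_ j) F y| <= e'.
  by have /cvgrPdist_le := cF j; exact.
have cF' := filter_forall (nbhs_filter x) cFj.
have [d /= d0 dP] := (nbhs_ballP _ _).1 (filterI dF cF').
apply/nbhs_ballP; exists d => //= v; rewrite -ball_normE /= sub0r normrN => vd.
have [y j yx|z zx E] := @increment_MVT F x v.
  have [//|+ _] := dP y; first by rewrite -ball_normE /= distrC; exact: le_lt_trans vd.
  exact.
rewrite [v + x]addrC opprD addrA E /lincomb -sumrB.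
apply: le_trans (ler_norm_sum _ _ _) _.
apply: (@le_trans _ _ (\sum_(j < n) (`|v| * e'))); last first.
  rewrite sumr_const card_ord -mulr_natr -mulrA mulrC ler_wpM2r//.
  by rewrite /e' mulrAC ler_pdivrMr// ler_pM2l// ler_nat.
apply: ler_sum => j _; rewrite -mulrBr normrM ler_pM// ?coord_le_norm//.
rewrite distrC; have [//|_ +] := dP (z j); last exact.
by rewrite -ball_normE /= distrC; exact: le_lt_trans vd.
Qed.

Lemma C1_differentiable F x :
  (\forall y \near x, forall j, derivable F y (e_ j)) ->
  (forall j, {for x, continuous ('D_(e_ j) F)}) ->
  differentiable F x.
Proof.
move=> dF cF; have E := C1_diff_littleo dF cF.
have D : 'd F x = lincomb (fun j => 'D_(e_ j) F x) :> ('rV[R]_n -> R).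
  apply: (@diff_unique _ _ _ F (lincomb (fun j => 'D_(e_ j) F x)) x).
    exact: lincomb_continuous.
  by apply/eqaddoP => e e0; exact: E.
apply/diff_locallyP; rewrite D; split; first exact: lincomb_continuous.
by apply/eqaddoP => e e0; exact: E.
Qed.

Lemma derive_differentiable F x v : differentiable F x ->
  'D_v F x = \sum_j v 0 j * 'D_(e_ j) F x.
Proof.
move=> dF; rewrite deriveE// [v in LHS]row_sum_delta linear_sum.
by apply: eq_bigr => j _; rewrite linearZ deriveE.
Qed.

Lemma differentiable_rV m (G : 'rV[R]_m -> 'rV[R]_n) y0 :
  (forall j, differentiable (fun y => G y 0 j) y0) -> differentiable G y0.
Proof.
move=> dG; have -> : G = \sum_j (fun y => G y 0 j *: e_ j).
  by apply/funext => y; rewrite fct_sumE; exact: row_sum_delta.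
by apply: differentiable_sum => j; exact: differentiableZl.
Qed.

(** The chain rule in coordinates, in the form that the induction for smoothness of composites
    uses. *)
Lemma derive_comp F m (G : 'rV[R]_m -> 'rV[R]_n) y0 w :
  (forall j, differentiable (fun y => G y 0 j) y0) -> differentiable F (G y0) ->
  'D_w (F \o G) y0 = \sum_j 'D_w (fun y => G y 0 j) y0 * 'D_(e_ j) F (G y0).
Proof.
move=> dG dF; have dG' := differentiable_rV dG.
rewrite deriveE; last exact: differentiable_comp.
rewrite diff_comp//= -deriveE// derive_differentiable//; apply: eq_bigr => j _.
congr (_ * _); rewrite deriveE//.
have -> : (fun y => G y 0 j) = (fun u : 'rV[R]_n => u 0 j) \o G by [].
rewrite (@diff_comp _ _ _ _ G (fun u => u 0 j))//; last exact: differentiable_coord.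
rewrite /= -(derive_coord ('d G y0 w) j (G y0)) deriveE//.
exact: differentiable_coord.
Qed.

End MultivariateCalculus.

(** * Locality, sums and composition of functions of class C^k *)

Section SmoothOnTheory.
Variables (R : realType) (n : nat).
Implicit Types (U V : set 'rV[R]_n) (F f g : 'rV[R]_n -> R).
Local Notation e_ j := (delta_mx 0 j : 'rV[R]_n).

Lemma Ck_on_continuous k U f x : Ck_on k U f -> U x -> {for x, continuous f}.
Proof. by case: k => [|k] [cf _] /cf. Qed.

(** [Ck_on] tests absolute continuity and derivability one point at a time, so any cover of [U]
    suffices. *)
Lemma Ck_on_local k U f :
  (forall x, U x -> exists2 V, V x & Ck_on k V f) -> Ck_on k U f.
Proof.
elim: k f => [|k IH] f loc; split=> //; try by
  move=> x /loc[V Vx fV]; exact: Ck_on_continuous fV Vx.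
move=> i; split=> [x /loc[V Vx [_ /(_ i)[df _]]]|]; first exact: df.
by apply: IH => x /loc[V Vx [_ /(_ i)[_ Df]]]; exists V.
Qed.

Lemma Ck_on_subset k U V f : U `<=` V -> Ck_on k V f -> Ck_on k U f.
Proof. by move=> UV fV; apply: Ck_on_local => x /UV; exists V. Qed.

Lemma Ck_on_sum k U (I : Type) (r : seq I) (f : I -> 'rV[R]_n -> R) : open U ->
  (forall i, Ck_on k U (f i)) -> Ck_on k U (\sum_(i <- r) f i).
Proof.
move=> oU fU; elim/big_ind: _ => // [|g h gU hU]; first exact: (Ck_on_cst k 0 oU).
by have := Ck_on_lin 1 oU gU hU; rewrite scale1r.
Qed.

Lemma Ck_on_coord k U j : open U -> Ck_on k U (fun x => x 0 j).
Proof.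
move=> oU; case: k => [|k]; (split=> //; first by move=> x _; exact: coord_continuous).
move=> i; split=> [x _|].
  by apply: diff_derivable; exact: differentiable_coord.
apply: Ck_on_eq (Ck_on_cst k (e_ i 0 j) oU) => // x _.
by rewrite derive_coord.
Qed.

Lemma Ck_on_differentiable k U f x : open U -> Ck_on k.+1 U f -> U x ->
  differentiable f x.
Proof.
move=> oU [_ df] Ux; apply: C1_differentiable => [|j].
  apply: filterS (open_nbhs_nbhs (conj oU Ux)) => y Uy j.
  exact: (df j).1.
exact: Ck_on_continuous (df j).2 Ux.
Qed.

Lemma rV_continuous (T : topologicalType) (G : T -> 'rV[R]_n) (t : T) :
  (forall j, {for t, continuous (fun y => G y 0 j)}) -> {for t, continuous G}.
Proof.
move=> cG; apply/cvgrPdist_le => e e0.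
have cGj j : \forall y \near t, `|G t 0 j - G y 0 j| <= e.
  by have /cvgrPdist_le := cG j; exact.
apply: filterS (filter_forall (nbhs_filter t) cGj) => y Gy.
by apply: norm_le_coord => [|j]; [exact: ltW|rewrite !mxE].
Qed.

End SmoothOnTheory.

Section SmoothOnComposition.
Variables (R : realType) (n : nat).
Local Notation e_ j := (delta_mx 0 j : 'rV[R]_n).

(** Induction on [k]: by the chain rule a partial derivative of [F \o G] is a sum of products of a
    partial derivative of [G] with a composite (partial derivative of [F]) [\o G], and both factors
    have one order less. *)
Lemma Ck_on_comp m k (U : set 'rV[R]_n) (V : set 'rV[R]_m) (F : 'rV[R]_m -> R) G :
  open U -> open V -> (forall x, U x -> V (G x)) -> Ck_on k V F ->
  (forall j, Ck_on k U (fun x => G x 0 j)) -> Ck_on k U (F \o G).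
Proof.
move=> oU oV UV; elim: k F => [|k IH] F FV GU; split=> //; try by
  move=> x Ux; apply: continuous_comp; [
    apply: rV_continuous => j; exact: Ck_on_continuous (GU j) Ux
  | exact: Ck_on_continuous FV (UV _ Ux)].
have dG x : U x -> forall j, differentiable (fun y => G y 0 j) x.
  by move=> Ux j; exact: Ck_on_differentiable (GU j) Ux.
have dF x : U x -> differentiable F (G x).
  by move=> /UV; exact: Ck_on_differentiable FV.
move=> i; split=> [x Ux|].
  apply: diff_derivable; apply: differentiable_comp; last exact: dF.
  by apply: differentiable_rV; exact: dG.
have S := Ck_on_sum (index_enum 'I_m) oU (f := fun j =>
  'D_(e_ i) (fun y => G y 0 j) * ('D_(delta_mx 0 j) F \o G)).
apply: Ck_on_eq (S k _) => // [x Ux|j].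
  by rewrite derive_comp ?fct_sumE//; [exact: dG|exact: dF].
apply: Ck_on_mul => //; first by have [_ /(_ i)[]] := GU j.
apply: IH => [|l]; first by have [_ /(_ j)[]] := FV.
exact: Ck_on_pred.
Qed.

End SmoothOnComposition.

(** * Flat functions and smooth bumps *)

Section FlatFunction.
Variable R : realType.

(* All powers [t ^- m] are kept because this family, unlike [exp (- 1 / t)]
   alone, is closed under differentiation up to linear combinations. *)
Definition flat (m : nat) (t : R) : R :=
  if 0 < t then t^-1 ^+ m * expR (- t^-1) else 0.

Lemma flat_gt0 m t : 0 < t -> 0 < flat m t.
Proof. by move=> t0; rewrite /flat t0 mulr_gt0 ?expR_gt0// exprn_gt0 ?invr_gt0. Qed.

Lemma flat_ge0 m t : 0 <= flat m t.
Proof.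
rewrite /flat; case: ifPn => // t0.
by rewrite mulr_ge0 ?expR_ge0// exprn_ge0 ?invr_ge0 ?ltW.
Qed.

Lemma flat_le0 m t : t <= 0 -> flat m t = 0.
Proof. by rewrite /flat; case: ltP. Qed.

(** One term of the exponential series at [1 / t] bounds [expR (1 / t)] from below. The order
    [m + 2] leaves a factor [t ^ 2], enough for the derivative at 0 to vanish. *)
Lemma flat_le m t : flat m t <= m.+2`!%:R * t ^+ 2.
Proof.
rewrite /flat; case: ifPn => [t0|_]; last by rewrite mulr_ge0// sqr_ge0.
have f0 : 0 < (m.+2`!%:R : R) by rewrite ltr0n fact_gt0.
have le : (t^-1) ^+ m.+2 / m.+2`!%:R <= expR t^-1.
  by rewrite (le_trans _ (expR_ge1Dxn m.+1 _)) ?lerDr// invr_ge0 ltW.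
rewrite expRN ler_pdivrMr ?expR_gt0//.
rewrite -ler_pdivrMl ?mulr_gt0// ?exprn_gt0//.
apply: le_trans le; rewrite le_eqVlt; apply/orP; left; apply/eqP.
by rewrite invfM -exprVn [in RHS]exprSr [in RHS]exprSr -!mulrA mulrC; ring.
Qed.

Lemma is_derive_flat0 m : is_derive (0 : R) 1 (flat m) 0.
Proof.
have c0 : 0 < (m.+2`!%:R : R) by rewrite ltr0n fact_gt0.
suff L : (fun h : R => h^-1 *: ((flat m \o shift 0) (h *: 1) - flat m 0)) @ 0^' --> (0 : R).
  by split; [exact: cvgP L|exact: cvg_lim L].
apply/cvgrPdist_le => e e0.
apply/nbhs_ballP; exists (e / m.+2`!%:R); first by rewrite /= divr_gt0.
move=> h; rewrite -ball_normE /= sub0r normrN ltr_pdivlMr// => he h0.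
rewrite sub0r normrN (flat_le0 m (lexx 0)) subr0 addr0 normrM normfV.
rewrite ler_pdivrMl ?normr_gt0//.
rewrite [h *: 1]mulr1 ger0_norm ?flat_ge0// (le_trans (flat_le _ _))//.
rewrite -[h ^+ 2]real_normK ?num_real// expr2 mulrA mulrC ler_wpM2l// mulrC; exact: ltW.
Qed.

(** For [t > 0] this differentiates [t ^- m * exp (- 1 / t)]; for [t < 0] the function is locally
    zero; at 0 the quadratic bound decides. *)
Lemma is_derive_flat m (t : R) :
  is_derive t 1 (flat m) (flat m.+2 t - m%:R * flat m.+1 t).
Proof.
have [t0|t0|->] := ltgtP t 0.
- rewrite !flat_le0 ?ltW// mulr0 subr0.
  apply: (@near_eq_is_derive _ _ _ (cst (0 : R))).
  by near=> s; rewrite flat_le0// ltW//; near: s; exact: lt_nbhsl.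
- apply: (@near_eq_is_derive _ _ _ ((fun s => s^-1) ^+ m * (expR \o (fun s => - s^-1)))).
    near=> s; rewrite /flat ifT; last by near: s; exact: lt_nbhsr.
    by rewrite mulrfctE exprfctE.
  have dV : is_derive t 1 (fun s : R => s^-1) (- t ^- 2).
    by apply: (is_derive_eq (is_deriveV _ _)); rewrite ?gt_eqF// [_ *: _]mulr1.
  have dN : is_derive t 1 (fun s : R => - s^-1) (t ^- 2).
    by apply: (is_derive_eq (is_deriveN _)); rewrite opprK.
  apply: (is_derive_eq (is_deriveM _ _)).
  have scE (a b : R) : a *: b = a * b by [].
  rewrite /flat t0 exprfctE !scE -exprVn.
  case: m => [|m] /=; first by rewrite expr0 !mul0r; ring.
  by rewrite !exprS expr0; ring.
- rewrite !flat_le0 ?mulr0 ?subr0//; exact: is_derive_flat0.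
Unshelve. all: by end_near. Qed.

(** Induction on [k] for all [m] at once, since differentiating raises [m]. *)
Lemma Ck_on_flat n k m (j : 'I_n) :
  Ck_on k [set: 'rV[R]_n] (fun y => flat m (y 0 j)).
Proof.
have dflat i (s : R) : differentiable (flat i) s.
  by apply/derivable1_diffP; have [] := is_derive_flat i s.
have df i (y : 'rV[R]_n) : differentiable (fun z : 'rV[R]_n => flat i (z 0 j)) y.
  by apply: differentiable_comp => //; exact: differentiable_coord.
elim: k m => [|k IH] m; (split; first by move=> y _; exact: differentiable_continuous).
  by [].
move=> i; split=> [y _|]; first exact: diff_derivable.
(* The partial derivative is the derivative of [flat m] times the constant [(e_i)_j]. *)
have c0 := Ck_on_cst k ((delta_mx 0 i : 'rV[R]_n) 0 j) (@openT 'rV[R]_n).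
have c1 := Ck_on_lin (- m%:R) openT (IH m.+1) (IH m.+2).
apply: (Ck_on_eq openT _ (Ck_on_mul openT c0 c1)).
move=> y _.
pose c (z : 'rV[R]_n) : R := z 0 j; pose v : 'rV[R]_n := delta_mx 0 i.
have dc : differentiable c y by exact: differentiable_coord.
rewrite [RHS](_ : _ = 'd (flat m) (c y) ('d c y v)); last first.
  have D : differentiable (flat m \o c) y by exact: (df m).
  by apply: eq_trans (deriveE v D) _; rewrite diff_comp.
rewrite -(deriveE v dc) derive_coord.
have -> : 'd (flat m) (c y) (v 0 j) = v 0 j *: 'd (flat m) (c y) 1.
  by rewrite -linearZ/= [_ *: 1]mulr1.
rewrite -deriveE//; have [_ ->] := is_derive_flat m (c y).
by congr (_ * _); rewrite addrC -mulNr.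
Qed.

End FlatFunction.

Section Bump.
Variables (R : realType) (n : nat).

(** Balls of the sup norm are cubes, so a product of one-variable bumps has the right support; for
    [r > 0] each factor is positive exactly when [|x_j - p_j| < r]. *)
Definition bump (p : 'rV[R]_n) (r : R) (x : 'rV[R]_n) : R :=
  \prod_j flat 0 (r ^+ 2 - (x 0 j - p 0 j) ^+ 2).

Lemma bump_neq0 p r : 0 < r -> bump p r p != 0.
Proof.
move=> r0; apply/prodf_neq0 => j _.
by rewrite gt_eqF// flat_gt0// subrr expr0n subr0 exprn_gt0.
Qed.

Lemma bump_support p r x : 0 < r -> bump p r x != 0 -> `|p - x| <= r.
Proof.
move=> r0 /prodf_neq0 b0; apply: norm_le_coord => [|j]; first exact: ltW.
rewrite !mxE distrC leNgt; apply/negP => rx; have /negP := b0 j isT; apply.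
rewrite flat_le0// subr_le0 -[leRHS]real_normK ?num_real//.
by rewrite ler_pXn2r ?nnegrE// ltW.
Qed.

Lemma bump_smooth p r : smooth_on setT (bump p r).
Proof.
move=> k.
have -> : bump p r = (fun y : 'rV[R]_n => \prod_j flat 0 (y 0 j)) \o
    (fun x => \row_j (r ^+ 2 - (x 0 j - p 0 j) ^+ 2)).
  by apply/funext => x /=; apply: eq_bigr => j _; rewrite mxE.
apply: (@Ck_on_comp R n n k setT setT (fun y => \prod_j flat 0 (y 0 j))
  (fun x => \row_j (r ^+ 2 - (x 0 j - p 0 j) ^+ 2)) openT openT (fun _ _ => I)).
  have -> : (fun y : 'rV[R]_n => \prod_j flat 0 (y 0 j)) =
      \prod_j (fun y : 'rV[R]_n => flat 0 (y 0 j)).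
    by apply/funext => y; rewrite fct_prodE.
  elim/big_ind: _ => [|f g cf cg|j _]; last exact: Ck_on_flat.
    exact: (Ck_on_cst k 1 openT).
  exact: Ck_on_mul openT cf cg.
move=> j.
have cl : Ck_on k [set: 'rV[R]_n] (fun x => x 0 j - p 0 j).
  have := Ck_on_lin 1 openT (Ck_on_coord k j openT) (Ck_on_cst k (- p 0 j) openT).
  by rewrite scale1r.
have c2 := Ck_on_lin (- 1) openT (Ck_on_mul openT cl cl)
  (Ck_on_cst k (r ^+ 2) (@openT 'rV[R]_n)).
apply: (Ck_on_eq openT _ c2) => x _; rewrite mxE; set a := x 0 j - p 0 j.
by rewrite -[LHS]/(-1 * (a * a) + r ^+ 2); ring.
Qed.

End Bump.

(** * Hadamard's lemma *)

Section Averages.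
Variables (R : realType) (n : nat).
Variables (U : set 'rV[R]_n) (p : 'rV[R]_n) (r : R).
Hypotheses (r0 : 0 < r) (oU : open U) (pU : forall x, `|x - p| <= r -> U x).
Implicit Types (f h : 'rV[R]_n -> R) (x q v : 'rV[R]_n).
Local Notation e_ j := (delta_mx 0 j : 'rV[R]_n).
Local Notation B := [set x : 'rV[R]_n | `|x - p| < r].
Local Notation mu := (@lebesgue_measure R).

Lemma smooth_on_derive f j : smooth_on U f -> smooth_on U ('D_(e_ j) f).
Proof. by move=> sf k; have [_ /(_ j)[]] := sf k.+1. Qed.

Lemma smooth_on_continuous f x : smooth_on U f -> U x -> {for x, continuous f}.
Proof. by move=> sf; exact: Ck_on_continuous (sf 0%N). Qed.

Lemma smooth_on_differentiable f x : smooth_on U f -> U x -> differentiable f x.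
Proof. by move=> sf; exact: Ck_on_differentiable oU (sf 1%N). Qed.

Lemma open_norm_ball : open B.
Proof.
rewrite [X in open X](_ : _ = ball p r); first exact: ball_open.
by apply/seteqP; split=> x; rewrite -ball_normE /= distrC.
Qed.

Lemma compact_norm_ball : compact [set x : 'rV[R]_n | `|x - p| <= r].
Proof.
rewrite [X in compact X](_ : _ = closed_ball p r); last first.
  by rewrite closed_ballE//; apply/seteqP; split=> x /=; rewrite /closed_ball_ /= distrC.
apply: bounded_closed_compact; last exact: closed_ball_closed.
rewrite closed_ballE//; exists (`|p| + r); split; first exact: num_real.
move=> M rM x /= xp; apply: le_trans (ltW rM).
by rewrite -lerBlDl (le_trans _ xp)// distrC (le_trans _ (lerB_dist _ _)).
Qed.

(** The closed ball is compact and lies in [U] by [pU]. The bound serves as the integrable majorant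
    when differentiating under the integral sign. *)
Lemma smooth_on_bounded f : smooth_on U f ->
  exists2 M, 0 <= M & forall x, `|x - p| <= r -> `|f x| <= M.
Proof.
move=> sf; have : compact (f @` [set x : 'rV[R]_n | `|x - p| <= r]).
  apply: continuous_compact; last exact: compact_norm_ball.
  apply/continuous_in_subspaceT => x; rewrite inE => /pU.
  exact: smooth_on_continuous.
move=> /compact_bounded[M [_ MP]]; exists (`|M| + 1) => [|x xp].
  by rewrite addr_ge0.
by apply: MP; [rewrite ltr_pwDr// ler_norm|exists x].
Qed.

Lemma segment_norm_ball q x (t : R) : B q -> B x -> 0 <= t <= 1 ->
  B (q + t *: (x - q)).
Proof.
move=> Bq Bx /andP[t0 t1] /=.
have -> : q + t *: (x - q) - p = (1 - t) *: (q - p) + t *: (x - p).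
  apply/rowP => j; rewrite !mxE; ring.
apply: le_lt_trans (ler_normD _ _) _; rewrite !normrZ !ger0_norm ?subr_ge0//.
apply: (@le_lt_trans _ _ (Num.max `|q - p| `|x - p|)); last by rewrite gt_max Bq.
have am : `|q - p| <= Num.max `|q - p| `|x - p| by rewrite le_max lexx.
have bm : `|x - p| <= Num.max `|q - p| `|x - p| by rewrite le_max lexx orbT.
move: am bm; set M := Num.max _ _ => am bm.
have s0 : 0 <= 1 - t by rewrite subr_ge0.
have := lerD (ler_wpM2l s0 am) (ler_wpM2l t0 bm).
by rewrite -mulrDl subrK mul1r.
Qed.

(** With [m = 0] and [h] a partial derivative of [f] these are Hadamard's coefficients. The weight
    [t ^ m] collects the factor [t] that each differentiation in [x] produces, which makes the
    family stable under derivatives. *)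
Definition average m h q x : R :=
  \int[mu]_(t in `[0, 1]) (t ^+ m * h (q + t *: (x - q))).

Lemma segment_continuous f q x : smooth_on U f -> B q -> B x ->
  {in `[0, 1], forall t : R, {for t, continuous (fun s : R => f (q + s *: (x - q)))}}.
Proof.
move=> sf Bq Bx t; rewrite in_itv /= => t01.
apply: (@continuous_comp _ _ _ (fun t : R => q + t *: (x - q)) f).
  apply: continuousD; first exact: cst_continuous.
  exact: scalel_continuous.
apply: smooth_on_continuous => //; apply: pU; apply: ltW.
exact: segment_norm_ball.
Qed.

Lemma itv01_integrable (g : R -> R) :
  {in `[0, 1], forall t : R, {for t, continuous g}} ->
  mu.-integrable `[0, 1] (EFin \o g).
Proof.
move=> cg; apply: continuous_compact_integrable; first exact: segment_compact.
apply/continuous_in_subspaceT => t; rewrite inE; exact: cg.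
Qed.

Lemma average_integrable m f q x : smooth_on U f -> B q -> B x ->
  mu.-integrable `[0, 1] (EFin \o (fun t => t ^+ m * f (q + t *: (x - q)))).
Proof.
move=> sf Bq Bx; apply: itv01_integrable => t t01.
apply: continuousM; last exact: segment_continuous.
exact: exprn_continuous.
Qed.

Lemma average_bound m f q x M : smooth_on U f -> B q -> B x -> 0 <= M ->
  (forall y, `|y - p| <= r -> `|f y| <= M) -> `|average m f q x| <= M.
Proof.
move=> sf Bq Bx M0 fM.
have L := le_normr_Rintegral _ (average_integrable m sf Bq Bx).
apply: le_trans (L _) _; first exact: measurable_itv.
have -> : M = \int[mu]_(t in `[0, 1]) M.
  rewrite Rintegral_cst//= lebesgue_measure_itv/= lte_fin ltr01.
  by rewrite -EFinB /= subr0 mulr1.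
apply: le_Rintegral => //.
- apply: itv01_integrable => t t01.
  apply: continuous_comp; last exact: norm_continuous.
  apply: continuousM; first exact: exprn_continuous.
  exact: (segment_continuous sf Bq Bx t01).
- by apply: itv01_integrable => t _; exact: cst_continuous.
move=> t; rewrite /= in_itv /= => t01; have /andP[t0 t1] := t01.
rewrite normrM -[leRHS]mul1r ler_pM//.
  by rewrite ger0_norm ?exprn_ge0// exprn_ile1.
by apply: fM; apply: ltW; exact: segment_norm_ball.
Qed.

(** Differentiation under the integral sign along [x + s e_j]; the chain rule contributes one factor
    [t], hence [m.+1]. *)
Lemma is_derive_average m f q x j : smooth_on U f -> B q -> B x ->
  is_derive x (e_ j) (average m f q) (average m.+1 ('D_(e_ j) f) q x).
Proof.
(* As [e_j] has sup norm 1, the points [x + s e_j] with [|s| < d] stay in the ball. *)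
move=> sf Bq Bx; pose d := r - `|x - p|.
have d0 : 0 < d by rewrite subr_gt0.
pose Ph (s t : R) : R := t ^+ m * f (q + t *: (x + s *: e_ j - q)).
have Bs (s : R) : s \in `]- d, d[ -> B (x + s *: e_ j).
  rewrite in_itv /= -ltr_norml => sd.
  have -> : x + s *: e_ j - p = (x - p) + s *: e_ j by rewrite addrAC.
  apply: le_lt_trans (ler_normD _ _) _; rewrite -ltrBrDl -/d normrZ.
  apply: le_lt_trans sd; rewrite -[leRHS]mulr1 ler_wpM2l//.
  by apply: norm_le_coord => // i; rewrite delta_coord; case: eqP; rewrite ?normr1 ?normr0.
have sf' : smooth_on U ('D_(e_ j) f) by exact: smooth_on_derive.
have dPh (s t : R) : s \in `]- d, d[ -> t \in `[0, 1] -> is_derive s 1 (Ph ^~ t)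
    (t ^+ m.+1 * 'D_(e_ j) f (q + t *: (x + s *: e_ j - q))).
  move=> sI tI.
  have pt (s' : R) : q + t *: (x + s' *: e_ j - q) =
      (q + t *: (x - q)) + s' *: (t *: e_ j).
    by apply/rowP => i; rewrite !mxE; ring.
  have Uy : U (q + t *: (x + s *: e_ j - q)).
    apply: pU; apply: ltW; apply: segment_norm_ball => //; exact: Bs.
  have df : differentiable f (q + t *: (x + s *: e_ j - q)).
    exact: smooth_on_differentiable.
  have L : is_derive s 1 (fun s' => f ((q + t *: (x - q)) + s' *: (t *: e_ j)))
      ('D_(t *: e_ j) f (q + t *: (x + s *: e_ j - q))).
    by rewrite pt; apply: is_derive_line; rewrite -pt; exact: diff_derivable.
  have -> : Ph ^~ t = t ^+ m \*: (fun s' => f ((q + t *: (x - q)) + s' *: (t *: e_ j))).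
    by apply/funext => s'; rewrite /Ph pt.
  apply: (is_derive_eq (is_deriveZ _ _)).
  rewrite deriveE// linearZ/= -deriveE//.
  by rewrite [LHS]mulrA -exprSr.
have [M M0 MP] := smooth_on_bounded sf'.
have mI : measurable (`[(0 : R), 1] : set (measurableTypeR R)) by exact: measurable_itv.
have I0 : `](- d), d[%classic (0 : R) by rewrite /= in_itv /= oppr_lt0 d0.
have iPh (s : R) : `](- d), d[%classic s -> mu.-integrable `[0, 1] (EFin \o Ph s).
  by move=> sI; apply: average_integrable => //; exact: Bs.
have dP (s t : R) : `](- d), d[%classic s -> `[(0 : R), 1]%classic t ->
    derivable (Ph ^~ t) s 1.
  by move=> sI tI; have [] := dPh s t sI tI.
have iM : mu.-integrable `[0, 1] (EFin \o cst M).
  by apply: itv01_integrable => t _; exact: cst_continuous.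
have ubP (s t : R) : `](- d), d[%classic s -> `[(0 : R), 1]%classic t ->
    `|partial1of2 Ph s t| <= cst M t.
  move=> sI tI; rewrite partial1of2E; have [_ ->] := dPh s t sI tI.
  move: (tI); rewrite /= in_itv /= => t01; have /andP[t0 t1] := t01.
  rewrite normrM -[leRHS]mul1r ler_pM//.
    by rewrite ger0_norm ?exprn_ge0// exprn_ile1.
  by apply: MP; apply: ltW; apply: segment_norm_ball => //; exact: Bs.
have D1 := derivable_under_integral mI I0 iPh dP (fun _ => M0) iM ubP.
have D2 := differentiation_under_integral mI I0 iPh dP (fun _ => M0) iM ubP.
apply: is_derive_of_line; split; first exact: D1.
rewrite -derive1E; apply: eq_trans D2 _; apply: eq_Rintegral => t.
rewrite inE => tI; rewrite partial1of2E; have [_ ->] := dPh 0 t I0 tI.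
by rewrite scale0r addr0.
Qed.

(** The partial derivatives are themselves averages, bounded by some [M] on the ball, so
    [increment_MVT] gives the Lipschitz estimate with constant [n * M]. *)
Lemma average_continuous m f q x : smooth_on U f -> B q -> B x ->
  {for x, continuous (average m f q)}.
Proof.
move=> sf Bq Bx; pose d := r - `|x - p|.
have d0 : 0 < d by rewrite subr_gt0.
have [M M0 MP] : exists2 M, 0 <= M &
    forall j y, `|y - p| <= r -> `|'D_(e_ j) f y| <= M.
  have /choice[M MP] j : exists M, 0 <= M /\
      forall y, `|y - p| <= r -> `|'D_(e_ j) f y| <= M.
    by have [M ? ?] := smooth_on_bounded (smooth_on_derive j sf); exists M.
  (* The sum of the bounds for the separate directions serves all of them. *)
  exists (\sum_j M j); first by apply: sumr_ge0 => j _; exact: (MP j).1.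
  move=> j y yp; apply: le_trans ((MP j).2 y yp) _.
  by rewrite (bigD1 j)//= lerDl sumr_ge0// => i _; exact: (MP i).1.
apply/(@cvgrPdist_le _ _ _ (nbhs x) (nbhs_filter x)) => e e0.
(* Adding 1 keeps the constant positive when [n * M] is zero. *)
pose c := n%:R * M + 1; have c0 : 0 < c by rewrite ltr_pwDr// mulr_ge0.
apply/nbhs_ballP; exists (Num.min d (e / c)).
  by rewrite /= lt_min d0 divr_gt0.
move=> y; rewrite -ball_normE /= lt_min distrC => /andP[yd ye].
have near_x z : `|z - x| <= `|y - x| -> B z.
  move=> zx; rewrite /= -[z](subrK x) -addrA.
  apply: le_lt_trans (ler_normD _ _) _; rewrite -ltrBrDr.
  exact: le_lt_trans yd.
have [z j zx|z zP E] := @increment_MVT _ _ (average m f q) x (y - x).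
  by have [] := is_derive_average m j sf Bq (near_x _ zx).
have xy : x + (y - x) = y by rewrite addrC subrK.
rewrite distrC -[y in average m f q y]xy E.
apply: le_trans (ler_norm_sum _ _ _) _.
apply: (@le_trans _ _ (\sum_(j < n) (`|y - x| * M))).
  apply: ler_sum => j _; rewrite normrM ler_pM// ?coord_le_norm//.
  have [_ ->] := is_derive_average m j sf Bq (near_x _ (zP j)).
  apply: average_bound => //; first exact: smooth_on_derive.
    exact: near_x.
  exact: MP.
rewrite sumr_const card_ord -mulr_natl mulrCA mulrC.
move: ye; rewrite ltr_pdivlMr// => /ltW; apply: le_trans.
by rewrite mulrC ler_wpM2l// lerDl.
Qed.

Lemma average_Ck k m f q : smooth_on U f -> B q -> Ck_on k B (average m f q).
Proof.
elim: k m f => [|k IH] m f sf Bq; (split; first by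
  move=> x Bx; exact: average_continuous) => //.
move=> j; split=> [x Bx|]; first by have [] := is_derive_average m j sf Bq Bx.
have A := IH m.+1 _ (smooth_on_derive j sf) Bq.
apply: (Ck_on_eq open_norm_ball _ A) => x Bx.
by have [_ ->] := is_derive_average m j sf Bq Bx.
Qed.

End Averages.

Section Hadamard.
Variables (R : realType) (n : nat).
Variables (U : set 'rV[R]_n) (p : 'rV[R]_n) (r : R).
Hypotheses (r0 : 0 < r) (oU : open U) (pU : forall x, `|x - p| <= r -> U x).
Implicit Types (f h : 'rV[R]_n -> R) (x q v : 'rV[R]_n).
Local Notation e_ j := (delta_mx 0 j : 'rV[R]_n).
Local Notation B := [set x : 'rV[R]_n | `|x - p| < r].
Local Notation mu := (@lebesgue_measure R).

Lemma continuous_sum_for (T : topologicalType) (I : Type) (s : seq I)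
    (g : I -> T -> R) (t : T) :
  (forall j, {for t, continuous (g j)}) ->
  {for t, continuous (fun y => \sum_(j <- s) g j y)}.
Proof.
move=> cg; have -> : (fun y => \sum_(j <- s) g j y) = \sum_(j <- s) g j.
  by apply/funext => y; rewrite fct_sumE.
elim/big_ind: _ => // [|f h cf ch]; first exact: (@cst_continuous _ _ (0 : R)).
exact: continuousD.
Qed.

Lemma Rintegral01_lincomb (I : Type) (s : seq I) (c : I -> R) (g : I -> R -> R) :
  (forall j, {in `[0, 1], forall t : R, {for t, continuous (g j)}}) ->
  \int[mu]_(t in `[0, 1]) (\sum_(j <- s) c j * g j t) =
    \sum_(j <- s) c j * \int[mu]_(t in `[0, 1]) g j t.
Proof.
move=> cg.
have cc j : {in `[0, 1], forall t : R, {for t, continuous (fun t => c j * g j t)}}.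
  by move=> t tI; apply: continuousM; [exact: cst_continuous|exact: cg].
have mI : measurable (`[(0 : R), 1] : set (measurableTypeR R)) by exact: measurable_itv.
elim: s => [|j s IH].
  under eq_Rintegral do rewrite big_nil.
  by rewrite Rintegral_cst// mul0r big_nil.
under eq_Rintegral do rewrite big_cons.
rewrite RintegralD//; last first.
- apply: itv01_integrable => t tI; apply: continuous_sum_for => i; exact: cc.
- exact: itv01_integrable.
by rewrite big_cons IH RintegralZl//; exact: itv01_integrable.
Qed.

(** On the diagonal Hadamard's coefficients are the partial derivatives themselves; this is how the
    coordinate fields appear in the local frame. *)
Lemma average0_diag h q : average 0 h q q = h q.
Proof.
rewrite /average; have mI : measurable (`[(0 : R), 1] : set (measurableTypeR R)).
  exact: measurable_itv.
rewrite (@eq_Rintegral _ _ _ _ _ (cst (h q))) => [|t _].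
  by rewrite Rintegral_cst//= lebesgue_measure_itv/= lte_fin ltr01 -EFinB/= subr0 mulr1.
by rewrite expr0 mul1r subrr scaler0 addr0.
Qed.

(** The fundamental theorem of calculus on the segment from [q] to [x], with the integrand expanded
    by the chain rule. *)
Lemma hadamard f q x : smooth_on U f -> B q -> B x ->
  f x - f q = \sum_j (x 0 j - q 0 j) * average 0 ('D_(e_ j) f) q x.
Proof.
move=> sf Bq Bx.
pose gam (t : R) : R := f (q + t *: (x - q)).
pose dgam (t : R) : R := \sum_j (x - q) 0 j * 'D_(e_ j) f (q + t *: (x - q)).
have sD j : smooth_on U ('D_(e_ j) f) by exact: smooth_on_derive.
have cD j := segment_continuous pU (sD j) Bq Bx.
have cdgam : {in `[0, 1], forall t : R, {for t, continuous dgam}}.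
  move=> t tI; apply: continuous_sum_for => j.
  by apply: continuousM; [exact: cst_continuous|exact: cD].
have dP (t : R) : t \in `[0, 1] -> is_derive t 1 gam (dgam t).
  rewrite in_itv /= => t01.
  have df : differentiable f (q + t *: (x - q)).
    apply: (smooth_on_differentiable oU sf); apply: pU; apply: ltW.
    exact: segment_norm_ball.
  have L := is_derive_line (@diff_derivable _ _ _ f _ (x - q) df).
  by apply: (is_derive_eq L); rewrite derive_differentiable.
have cgam := segment_continuous pU sf Bq Bx.
have FTC : \int[mu]_(t in `[0, 1]) dgam t = gam 1 - gam 0.
  rewrite /Rintegral (@continuous_FTC2 _ dgam gam)//.
  - apply/continuous_in_subspaceT => t; rewrite inE; exact: cdgam.
  - split.
    + by move=> t /subset_itv_oo_cc/dP[].
    + by apply: cvg_at_right_filter; apply: cgam; rewrite in_itv /= lexx ler01.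
    + by apply: cvg_at_left_filter; apply: cgam; rewrite in_itv /= lexx ler01.
  - move=> t /subset_itv_oo_cc/dP[_ <-]; exact: derive1E.
have g0 : gam 0 = f q by rewrite /gam scale0r addr0.
have g1 : gam 1 = f x by rewrite /gam scale1r addrC subrK.
rewrite -g0 -g1 -FTC Rintegral01_lincomb//; apply: eq_bigr => j _.
rewrite !mxE /average; congr (_ * _); apply: eq_Rintegral => t _.
by rewrite expr0 mul1r.
Qed.

End Hadamard.

(** * Local frames on a manifold *)

Section SmoothFunctionTheory.
Variables (R : realType) (n : nat) (M : manifold R n).
Local Notation C := (smoothFun M).
Implicit Types (f g : C) (m : M).

Lemma smoothFun_ext f g : (forall m, f m = g m) -> f = g.
Proof. by move=> fg; apply/val_inj/funext. Qed.

Lemma smooth_mulE f g m : (f * g) m = f m * g m. Proof. by []. Qed.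
Lemma smooth_addE f g m : (f + g) m = f m + g m. Proof. by []. Qed.
Lemma smooth_oppE f m : (- f) m = - f m. Proof. by []. Qed.
Lemma smooth_scalE (a : R) f m : (a *: f) m = a * f m. Proof. by []. Qed.

Lemma smooth_cstE (a : R) m : smooth_cst M a m = a. Proof. by []. Qed.

Lemma smooth_sumE (I : Type) (s : seq I) (F : I -> C) m :
  (\sum_(i <- s) F i) m = \sum_(i <- s) F i m.
Proof. by elim: s => [|i s IH]; rewrite ?big_nil ?big_cons ?smooth_addE ?IH. Qed.

Lemma vf_sum (X : vectorField M) (I : Type) (s : seq I) (F : I -> C) :
  X (\sum_(i <- s) F i) = \sum_(i <- s) X (F i).
Proof. by elim: s => [|i s IH]; rewrite ?big_nil ?vf0 ?big_cons ?vfD ?IH. Qed.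

Lemma vf1 (X : vectorField M) : X 1 = 0.
Proof.
have := vfM X 1 1; rewrite !mulr1 mul1r => /eqP.
by rewrite -subr_eq subrr => /eqP.
Qed.

Lemma vf_cst (X : vectorField M) (k : R) : X (smooth_cst M k) = 0.
Proof. by have := vfZ X k 1; rewrite vf1 scaler0 smooth_scaleE mulr1. Qed.

(** The image is the part of the open chart image that the inverse chart, which is continuous there,
    sends into [O]. *)
Lemma open_chart_image (d : chart R n M) (O : set M) : open O ->
  open (d @` (chart_dom d `&` O)).
Proof.
move=> oO; rewrite openE => _ [m [dm Om] <-].
have dU : (d @` chart_dom d) (d m) by exists m.
have dn := open_nbhs_nbhs (conj (@chart_img_open _ _ _ d) dU).
have cn : nbhs (d m) (chart_inv d @^-1` O).
  apply: (chart_inv_continuous dU); apply: open_nbhs_nbhs.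
  by split=> //; rewrite chart_mapK.
apply: filterS (filterI dn cn) => _ [[m' dm' <-]] /= O'.
by exists m' => //; split=> //; rewrite -(chart_mapK dm').
Qed.

End SmoothFunctionTheory.

(** * Extending cut-off functions from a chart by zero *)

Section ExtensionByZero.
Variables (R : realType) (n : nat) (M : manifold R n).
Local Notation C := (smoothFun M).
Variables (c : chart R n M) (ac : atlas c) (p : 'rV[R]_n) (r rho : R).
Local Notation U := (c @` chart_dom c).
Hypotheses (r0 : 0 < r) (rrho : r < rho) (pU : forall x, `|x - p| <= rho -> U x).
Local Notation B := [set x : 'rV[R]_n | `|x - p| < rho].
Local Notation e_ j := (delta_mx 0 j : 'rV[R]_n).

(** Because [r < rho], the ball [B] and the region [|y - p| > r], where the bump vanishes, cover the
    whole space. *)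
Lemma bump_mul_Ck k (g : 'rV[R]_n -> R) : Ck_on k B g ->
  Ck_on k setT (bump p r * g).
Proof.
move=> gB; apply: Ck_on_local => x _; have [xB|xB] := ltP `|x - p| rho.
  exists B => //; apply: Ck_on_mul => //; first exact: open_norm_ball.
  by apply: Ck_on_subset (bump_smooth p r k).
pose V := [set y : 'rV[R]_n | r < `|y - p|].
exists V; first by rewrite /V /=; exact: lt_le_trans xB.
have oV : open V.
  apply: (@open_comp _ _ (fun y : 'rV[R]_n => `|y - p|) [set s : R | r < s]);
    last exact: open_gt.
  move=> y _; apply: continuous_comp; last exact: norm_continuous.
  by apply: continuousD; [exact: cvg_id|exact: cst_continuous].
apply: (Ck_on_eq oV _ (Ck_on_cst k 0 oV)) => y Vy.
rewrite -[RHS]/(bump p r y * g y); have [->|] := eqVneq (bump p r y) 0.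
  by rewrite mul0r.
by move=> /(bump_support r0); rewrite distrC leNgt Vy.
Qed.

Definition ext0 (g : 'rV[R]_n -> R) (m : M) : R :=
  if m \in chart_dom c then bump p r (c m) * g (c m) else 0.

(** Inside the domain of [c] the transition map carries smoothness over to the chart [d]; outside it
    the function vanishes on a neighbourhood. *)
Lemma ext0_smooth g : smooth_on B g -> is_smooth (ext0 g).
Proof.
move=> gB d ad k; apply: Ck_on_local => _ [m dm <-].
have [cm|cm] := pselect (chart_dom c m).
  exists (d @` (chart_dom d `&` chart_dom c)); first by exists m.
  have oV := @open_chart_image _ _ _ d _ (@chart_dom_open _ _ _ c).
  have H := Ck_on_comp oV openT (fun _ _ => I) (bump_mul_Ck (gB k))
    (fun j => atlas_compat ad ac j k).
  apply: (Ck_on_eq oV _ H) => _ [m' [dm' cm'] <-] /=.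
  by rewrite /ext0 chart_mapK// mem_set.
(* [K] is compact and contains the points where the extension is nonzero. The Hausdorff property
   makes it closed, so its complement is the required neighbourhood. *)
pose K := chart_inv c @` [set x : 'rV[R]_n | `|x - p| <= r].
have rU x : `|x - p| <= r -> U x by move=> xr; apply: pU; exact: le_trans (ltW rrho).
have cK : closed K.
  apply: compact_closed; first exact: mf_hausdorff.
  apply: continuous_compact; last exact: compact_norm_ball.
  apply/continuous_in_subspaceT => x; rewrite inE => /rU.
  exact: chart_inv_continuous.
have nK : (~` K) m.
  move=> [x /rU[m' cm' <-] mm']; apply: cm.
  by rewrite -mm' chart_mapK.
exists (d @` (chart_dom d `&` ~` K)); first by exists m.
have oV := @open_chart_image _ _ _ d _ (closed_openC cK).
apply: (Ck_on_eq oV _ (Ck_on_cst k 0 oV)) => _ [m' [dm' nKm'] <-] /=.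
rewrite /ext0 chart_mapK//; case: ifPn => //; rewrite inE => cm'.
have [->|/(bump_support r0)] := eqVneq (bump p r (c m')) 0; first by rewrite mul0r.
by rewrite distrC => b; case: nKm'; exists (c m') => //; rewrite chart_mapK.
Qed.

End ExtensionByZero.

(** * Cut-off coordinate vector fields spanning all derivations locally *)

Section LocalFrame.
Variables (R : realType) (n : nat) (M : manifold R n).
Local Notation C := (smoothFun M).
Variables (c : chart R n M) (ac : atlas c) (p : 'rV[R]_n) (r rho : R).
Local Notation U := (c @` chart_dom c).
Hypotheses (r0 : 0 < r) (rrho : r < rho) (pU : forall x, `|x - p| <= rho -> U x).
Local Notation B := [set x : 'rV[R]_n | `|x - p| < rho].
Local Notation e_ j := (delta_mx 0 j : 'rV[R]_n).

Lemma norm_ball_open : open B.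
Proof. exact: open_norm_ball. Qed.

Lemma smooth_on_chart_ball (g : 'rV[R]_n -> R) : smooth_on U g -> smooth_on B g.
Proof. by move=> gU k; apply: Ck_on_subset (gU k) => x /ltW/pU. Qed.

Definition ext_smooth (g : 'rV[R]_n -> R) (gB : smooth_on B g) : C :=
  SmoothFun (asboolT (ext0_smooth ac r0 rrho pU gB)).

Lemma ext_smoothE g (gB : smooth_on B g) m :
  ext_smooth gB m = ext0 c p r g m.
Proof. by []. Qed.

Definition rep (f : C) : 'rV[R]_n -> R := f \o chart_inv c.

Lemma rep_smooth f : smooth_on U (rep f).
Proof. by have /asboolP := smoothFunP f; apply. Qed.

Lemma rep_derive_smooth f j : smooth_on B ('D_(e_ j) (rep f)).
Proof. by apply: smooth_on_chart_ball; apply: smooth_on_derive; exact: rep_smooth. Qed.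

Lemma rep_derivable f j m : chart_dom c m -> derivable (rep f) (c m) (e_ j).
Proof.
move=> cm; have [_ /(_ j)[+ _]] := rep_smooth f 1%N; apply.
by exists m.
Qed.

(** The vector field bump times d/dx_j: the factor bump sits inside [ext0]. *)
Definition frame_fun (j : 'I_n) (f : C) : C := ext_smooth (rep_derive_smooth f j).

Lemma frame_derivation j : frame_fun j \in @derivation_pred R n M.
Proof.
apply/asboolP; split=> [a f g|f g]; apply: smoothFun_ext => m.
  rewrite smooth_addE smooth_scalE !ext_smoothE /ext0; case: ifPn => [|_].
    rewrite inE => cm.
    have -> : rep (a *: f + g) = a *: rep f + rep g by [].
    have df := @rep_derivable f j m cm; have dg := @rep_derivable g j m cm.
    rewrite (deriveD (derivableZ (k := a) df) dg) (deriveZ a df).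
    have sE (s t : R) : s *: t = s * t by [].
    by rewrite sE mulrDr mulrCA.
  by rewrite mulr0 addr0.
rewrite smooth_addE !smooth_mulE !ext_smoothE /ext0; case: ifPn => [|_].
  rewrite inE => cm.
  have -> : rep (f * g) = rep f * rep g by [].
  have df := @rep_derivable f j m cm; have dg := @rep_derivable g j m cm.
  rewrite (deriveM df dg).
  have sE (a b : R) : a *: b = a * b by [].
  have rE h : rep h (c m) = h m by rewrite /rep /= chart_mapK.
  by rewrite !sE !rE; ring.
by rewrite mul0r mulr0 addr0.
Qed.

Definition frame j : vectorField M := VectorField (frame_derivation j).

Lemma one_smooth : smooth_on B (cst 1).
Proof. by move=> k; exact: Ck_on_cst norm_ball_open. Qed.

Lemma coord_smooth j : smooth_on B (fun x => x 0 j).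
Proof. by move=> k; exact: Ck_on_coord norm_ball_open. Qed.

(** The bump itself and, next, the bump times a coordinate, as global smooth functions to which
    vector fields can be applied. *)
Definition cutoff : C := ext_smooth one_smooth.
Definition cutoff_coord j : C := ext_smooth (coord_smooth j).

(* Apply [X] at a point with coordinates [q] to Hadamard's formula
   [cutoff ^ 2 (f - f q) = \sum_j cutoff (x_j - q_j) * cutoff g_j]. *)
Lemma local_frame_spanning (X : vectorField M) (f : C) :
  cutoff ^+ 3 * X f =
  \sum_j (cutoff * X (cutoff_coord j) - cutoff_coord j * X cutoff) * frame j f.
Proof.
apply: smoothFun_ext => m; rewrite smooth_sumE.
have c3 : (cutoff ^+ 3) m = cutoff m * (cutoff m * cutoff m).
  by rewrite !exprS expr0 mulr1 !smooth_mulE.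
rewrite smooth_mulE c3; set chi := cutoff m.
(* Where the cutoff vanishes so does every [frame j f], and both sides are zero. *)
have [chi0|chi0] := eqVneq chi 0.
  rewrite chi0 !mul0r big1// => j _.
  rewrite smooth_mulE; suff -> : frame j f m = 0 by rewrite mulr0.
  move: chi0; rewrite /chi !ext_smoothE /ext0; case: ifPn => // _.
  by rewrite mulr1 => ->; rewrite mul0r.
have cm : chart_dom c m.
  by move: chi0; rewrite /chi ext_smoothE /ext0; case: ifPn => [/[1!inE]//|_]; rewrite eqxx.
pose q := c m.
have chiE : chi = bump p r q by rewrite /chi ext_smoothE /ext0 mem_set//= mulr1.
have suppB x : bump p r x != 0 -> B x.
  by move=> /(bump_support r0); rewrite distrC => xr; exact: le_lt_trans rrho.
have Bq : B q by apply: suppB; rewrite -chiE.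
have rho0 : 0 < rho by exact: lt_trans rrho.
have oU := @chart_img_open _ _ _ c.
have gB j : smooth_on B (average 0 ('D_(e_ j) (rep f)) q).
  move=> k; apply: (average_Ck rho0 oU pU) => //.
  by apply: smooth_on_derive; exact: rep_smooth.
pose G j := ext_smooth (gB j).
(* [Y j] is the bump times [x_j - q_j]; it vanishes at [m], so the Leibniz rule will leave only
   [X (Y j) * G j] there. *)
pose Y j : C := cutoff_coord j - q 0 j *: cutoff.
have hadamardM : cutoff * cutoff * (f - smooth_cst M (f m)) = \sum_j Y j * G j.
  apply: smoothFun_ext => m'; rewrite smooth_sumE !smooth_mulE.
  rewrite smooth_addE smooth_oppE !ext_smoothE.
  under eq_bigr do rewrite smooth_mulE smooth_addE smooth_oppE smooth_scalE !ext_smoothE.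
  rewrite /ext0; case: ifPn => [|_]; last first.
    by rewrite !mul0r big1// => j _; rewrite mulr0.
  rewrite inE => cm'; have [->|/suppB Bx] := eqVneq (bump p r (c m')) 0.
    by rewrite !mul0r big1// => j _; rewrite !mul0r mulr0.
  have := hadamard oU pU (rep_smooth f) Bq Bx.
  rewrite {1 2}/rep /= /q !chart_mapK// => H.
  rewrite H mulr_sumr; apply: eq_bigr => j _.
  by rewrite mulr1; ring.
(* At [m] the factor [f - f m] vanishes, so the left side reduces to [chi ^ 2 * X f]. *)
have : X (cutoff * cutoff * (f - smooth_cst M (f m))) m = X (\sum_j Y j * G j) m.
  by rewrite hadamardM.
rewrite vf_sum smooth_sumE !vfM vfD vfN vf_cst subr0.
rewrite !(smooth_addE, smooth_mulE, smooth_oppE, smooth_scalE).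
rewrite smooth_cstE subrr mulr0 add0r -/chi => E.
(* The third factor [chi] turns the constant [q_j] into [chi * q_j], the value of [cutoff_coord j]
   at [m]; thus the coefficients are smooth functions independent of the point. *)
rewrite -mulrA E mulr_sumr; apply: eq_bigr => j _.
have Y0 : Y j m = 0.
  rewrite smooth_addE smooth_oppE smooth_scalE !ext_smoothE /ext0 mem_set//.
  by rewrite -/q /= mulr1 mulrC subrr.
have GE : G j m = frame j f m.
  by rewrite !ext_smoothE /ext0 mem_set//= average0_diag.
have ccE : cutoff_coord j m = chi * q 0 j.
  by rewrite ext_smoothE /ext0 mem_set// chiE.
have XYG : X (Y j * G j) m = X (Y j) m * G j m + Y j m * X (G j) m.
  by rewrite vfM.
have XY : X (Y j) m = X (cutoff_coord j) m - q 0 j * X cutoff m.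
  by rewrite vfD vfN vfZ.
have fE : ((cutoff * X (cutoff_coord j) - cutoff_coord j * X cutoff) * frame j f) m =
    (chi * X (cutoff_coord j) m - cutoff_coord j m * X cutoff m) * frame j f m by [].
by rewrite XYG fE Y0 GE XY ccE; ring.
Qed.

End LocalFrame.

(** The only result on charts used from here on: [xi] are cut-off coordinates and [E] cut-off
    coordinate fields around [m]. *)
Lemma local_frame (R : realType) (n : nat) (M : manifold R n) (m : M) :
  exists (chi : smoothFun M) (xi : 'I_n -> smoothFun M) (E : 'I_n -> vectorField M),
    chi m != 0 /\ forall (X : vectorField M) (f : smoothFun M),
      chi ^+ 3 * X f = \sum_j (chi * X (xi j) - xi j * X chi) * E j f.
Proof.
have [c ac cm] := atlas_cover m.
have cU : (c @` chart_dom c) (c m) by exists m.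
have [rho /= rho0 rhoU] := (nbhs_ballP _ _).1
  (open_nbhs_nbhs (conj (@chart_img_open _ _ _ c) cU)).
(* The bump has radius [rho / 4], and the closed ball of radius [rho / 2] lies in the chart
   image. *)
have r0 : 0 < rho / 4 by rewrite divr_gt0.
have rr : rho / 4 < rho / 2 by lra.
have pU x : `|x - c m| <= rho / 2 -> (c @` chart_dom c) x.
  move=> xp; apply: rhoU; rewrite -ball_normE /= distrC (le_lt_trans xp)//.
  lra.
exists (cutoff ac r0 rr pU), (cutoff_coord ac r0 rr pU), (frame ac r0 rr pU).
split; last exact: local_frame_spanning.
by rewrite ext_smoothE /ext0 mem_set// mulr1 bump_neq0.
Qed.

(** * Poisson calculus *)

Section ExactForms.
Variables (R : realType) (n : nat) (M : manifold R n).
Local Notation C := (smoothFun M).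
Implicit Types (f g h : C) (a b : form1 M) (X Y Z : vectorField M).

Lemma form1DE a b X : (a + b) X = a X + b X. Proof. by []. Qed.
Lemma form1NE a X : (- a) X = - a X. Proof. by []. Qed.
Lemma form1ZE (k : R) a X : (k *: a) X = k *: a X. Proof. by []. Qed.
Lemma form10E X : (0 : form1 M) X = 0. Proof. by []. Qed.
Lemma f1_scaleE h a X : f1_scale h a X = h * a X. Proof. by []. Qed.
Lemma diff0E f X : diff0 f X = X f. Proof. by []. Qed.

Lemma f1_scaler_cst (k : R) a : k *: a = f1_scale (smooth_cst M k) a.
Proof. by apply: form1P => X; rewrite form1ZE smooth_scaleE. Qed.

Lemma f1_scale1 a : f1_scale 1 a = a.
Proof. by apply: form1P => X; rewrite f1_scaleE mul1r. Qed.

Lemma diff0_lin (k : R) f g :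
  diff0 (k *: f + g) = f1_scale (smooth_cst M k) (diff0 f) + diff0 g.
Proof.
by apply: form1P => X; rewrite form1DE f1_scaleE !diff0E vfD vfZ smooth_scaleE.
Qed.

Lemma diff0M f g : diff0 (f * g) = f1_scale g (diff0 f) + f1_scale f (diff0 g).
Proof.
by apply: form1P => X; rewrite form1DE !f1_scaleE !diff0E vfM; ring.
Qed.

Lemma diff0N f : diff0 (- f) = - diff0 f.
Proof. by apply: form1P => X; rewrite form1NE !diff0E vfN. Qed.

Lemma diff0D f g : diff0 (f + g) = diff0 f + diff0 g.
Proof. by apply: form1P => X; rewrite form1DE !diff0E vfD. Qed.

Lemma vf_sumE (I : Type) (s : seq I) (F : I -> vectorField M) f :
  (\sum_(i <- s) F i) f = \sum_(i <- s) F i f.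
Proof. by elim: s => [|i s IH]; rewrite ?big_nil ?big_cons ?vfDE ?IH. Qed.

Lemma form1_sum (I : Type) (s : seq I) (F : I -> vectorField M) a :
  a (\sum_(i <- s) F i) = \sum_(i <- s) a (F i).
Proof. by elim: s => [|i s IH]; rewrite ?big_nil ?form10 ?big_cons ?form1D ?IH. Qed.

Lemma form1_sumE (I : Type) (s : seq I) (F : I -> form1 M) X :
  (\sum_(i <- s) F i) X = \sum_(i <- s) F i X.
Proof. by elim: s => [|i s IH]; rewrite ?big_nil ?big_cons ?form1DE ?IH. Qed.

(* A local frame writes [chi ^ 3 a] as a combination of exact forms. *)
Lemma vanish_on_exact (Phi : form1 M -> C) :
  (forall h a b, Phi (f1_scale h a + b) = h * Phi a + Phi b) ->
  (forall f, Phi (diff0 f) = 0) -> forall a, Phi a = 0.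
Proof.
move=> PhiL Phid a.
have PhiD b b' : Phi (b + b') = Phi b + Phi b'.
  by rewrite -[b in LHS]f1_scale1 PhiL mul1r.
have Phi0 : Phi 0 = 0.
  have /eqP := PhiD 0 0; rewrite addr0.
  by rewrite -subr_eq subrr => /eqP.
have PhiS h b : Phi (f1_scale h b) = h * Phi b.
  by rewrite -[f1_scale h b]addr0 PhiL Phi0 addr0.
apply: smoothFun_ext => m.
have [chi [xi [E [chim frameE]]]] := local_frame m.
have aE : f1_scale (chi ^+ 3) a = \sum_j
    (f1_scale (a (E j) * chi) (diff0 (xi j)) + f1_scale (- (a (E j) * xi j)) (diff0 chi)).
  apply: form1P => X; rewrite form1_sumE f1_scaleE -form1S.
  have -> : vf_scale (chi ^+ 3) X =
      \sum_j vf_scale (chi * X (xi j) - xi j * X chi) (E j).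
    by apply: vectorFieldP => f; rewrite vf_scaleE frameE vf_sumE.
  rewrite form1_sum; apply: eq_bigr => j _.
  by rewrite form1S form1DE !f1_scaleE !diff0E; ring.
have P0 : chi ^+ 3 * Phi a = 0.
  rewrite -PhiS aE (big_morph Phi PhiD Phi0) big1// => j _.
  by rewrite PhiD !PhiS !Phid !mulr0 addr0.
have : (chi ^+ 3 * Phi a) m = 0 by rewrite P0.
rewrite !exprS expr0 mulr1 !smooth_mulE => /eqP.
by rewrite !mulf_eq0 (negbTE chim) /= => /eqP.
Qed.

End ExactForms.

(** * The anchor, the Koszul bracket and Cartan's formulas *)

Section Anchor.
Variables (R : realType) (n : nat) (M : manifold R n) (pi : poissonStructure M).
Local Notation C := (smoothFun M).
Local Notation sharp := (sharp pi).
Local Notation koszul := (koszul_br pi).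
Implicit Types (f g h : C) (a b c eta : form1 M) (X Y Z : vectorField M).

Lemma bivDl a b c : pi (a + b) c = pi a c + pi b c.
Proof. by have := biv_linl pi 1 a b c; rewrite f1_scale1 mul1r. Qed.

Lemma bivDr a b c : pi c (a + b) = pi c a + pi c b.
Proof. by have := biv_linr pi 1 a b c; rewrite f1_scale1 mul1r. Qed.

Lemma bivC a b : pi a b = - pi b a.
Proof.
apply/eqP; rewrite -addr_eq0; apply/eqP.
by have := biv_alt pi (a + b); rewrite bivDl !bivDr !biv_alt add0r addr0.
Qed.

Lemma biv0r a : pi a 0 = 0.
Proof.
have /eqP := bivDr 0 0 a; rewrite addr0.
by rewrite -subr_eq subrr => /eqP.
Qed.

Lemma bivSr h a b : pi b (f1_scale h a) = h * pi b a.
Proof. by rewrite -[f1_scale h a]addr0 biv_linr biv0r addr0. Qed.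

Lemma bivNr a b : pi b (- a) = - pi b a.
Proof. by apply/eqP; rewrite -addr_eq0 -bivDr addNr biv0r. Qed.

Lemma bivNl a b : pi (- a) b = - pi a b.
Proof. by rewrite bivC bivNr -bivC. Qed.

Lemma sharp_derivation a : (fun f => pi a (diff0 f)) \in @derivation_pred R n M.
Proof.
apply/asboolP; split=> [k f g|f g].
  by rewrite diff0_lin biv_linr smooth_scaleE.
by rewrite diff0M bivDr !bivSr; ring.
Qed.

(** The derivation [f |-> pi a (diff0 f)] has the defining property on exact forms by construction,
    hence on all forms by [vanish_on_exact]. So the set in [sharp] is inhabited and [xget] does not
    return its default. *)
Lemma sharpP a b : b (sharp a) = pi a b.
Proof.
pose X := VectorField (sharp_derivation a).
have XP (b' : form1 M) : b' X = pi a b'.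
  apply/eqP; rewrite -subr_eq0; apply/eqP.
  apply: (vanish_on_exact (Phi := fun b => b X - pi a b)) => [h b1 b2|f].
    by rewrite form1DE f1_scaleE biv_linr; ring.
  by rewrite diff0E subrr.
by have := @xgetPex _ 0 [set X | forall b, b X = pi a b] (ex_intro _ X XP) b.
Qed.

Lemma sharpE a f : sharp a f = pi a (diff0 f).
Proof. by rewrite -sharpP. Qed.

Lemma sharp_lin h a b : sharp (f1_scale h a + b) = vf_scale h (sharp a) + sharp b.
Proof. by apply: vectorFieldP => f; rewrite vfDE vf_scaleE !sharpE biv_linl. Qed.

Lemma sharpD a b : sharp (a + b) = sharp a + sharp b.
Proof. by apply: vectorFieldP => f; rewrite vfDE !sharpE bivDl. Qed.

Lemma sharpN a : sharp (- a) = - sharp a.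
Proof. by apply: vectorFieldP => f; rewrite vfNE !sharpE bivNl. Qed.

Lemma koszulE a b X : koszul a b X =
  sharp a (b X) - b (vf_bracket (sharp a) X)
  - (sharp b (a X) - a (vf_bracket (sharp b) X)) - X (pi a b).
Proof. by []. Qed.

Lemma koszulC a b : koszul a b = - koszul b a.
Proof. by apply: form1P => X; rewrite form1NE !koszulE (bivC a b) vfN; ring. Qed.

Lemma koszulXX a : koszul a a = 0.
Proof. by apply: form1P => X; rewrite koszulE subrr biv_alt vf0 subr0. Qed.

(** The Leibniz rule of the cotangent Lie algebroid, whose anchor is [sharp]. *)
Lemma koszul_linr h a b c : koszul c (f1_scale h a + b) =
  f1_scale h (koszul c a) + (f1_scale (sharp c h) a + koszul c b).
Proof.
apply: form1P => X; rewrite !(form1DE, f1_scaleE, koszulE) sharp_lin biv_linr.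
rewrite vf_bracketSDl !(form1D, form1N, form1S, sharpP).
rewrite !(vfDE, vf_scaleE, vfD, vfM) (bivC a c).
by ring.
Qed.

Lemma koszulDr a b c : koszul c (a + b) = koszul c a + koszul c b.
Proof.
apply: form1P => X; rewrite -[a in LHS]f1_scale1 koszul_linr.
by rewrite !(form1DE, f1_scaleE) vf1; ring.
Qed.

Lemma koszulNr a b : koszul b (- a) = - koszul b a.
Proof.
apply/eqP; rewrite -addr_eq0 -koszulDr addNr; apply/eqP.
have /eqP := koszulDr 0 0 b; rewrite addr0.
by rewrite -subr_eq subrr => /eqP.
Qed.

Lemma koszul_exact f g : koszul (diff0 f) (diff0 g) = diff0 (pi (diff0 f) (diff0 g)).
Proof.
apply: form1P => X; rewrite koszulE !diff0E !vf_bracketE !sharpE.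
by rewrite (bivC (diff0 g) (diff0 f)) vfN; ring.
Qed.

Lemma sharp_koszul a b : sharp (koszul a b) = vf_bracket (sharp a) (sharp b).
Proof.
apply: vectorFieldP => h; apply/eqP; rewrite -subr_eq0; apply/eqP.
(* The defect [T] is tensorial: both brackets obey the same Leibniz rule, so the terms that
   differentiate [k] cancel. Antisymmetry lets one slot stand for both. *)
pose T a b := sharp (koszul a b) h - vf_bracket (sharp a) (sharp b) h.
have TC x y : T x y = - T y x.
  by rewrite /T koszulC sharpN vf_bracketC !vfNE; ring.
have TL x k y y' : T x (f1_scale k y + y') = k * T x y + T x y'.
  rewrite /T koszul_linr !(sharp_lin, sharpD) vf_bracketSDr.
  by rewrite !(vfDE, vf_scaleE); ring.
rewrite -/(T a b); apply: (vanish_on_exact (TL a)) => g; rewrite TC.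
apply/eqP; rewrite oppr_eq0; apply/eqP; apply: (vanish_on_exact (TL _)) => f.
rewrite /T koszul_exact vf_bracketE !sharpE.
have := poisson_jacobi pi f g h; rewrite /poisson_br.
rewrite (bivC (diff0 h) (diff0 f)) diff0N bivNr => J.
rewrite (bivC (diff0 g) (diff0 f)) diff0N bivNl (bivC _ (diff0 h)) opprK -J.
by ring.
Qed.

Lemma sharp_koszul_f a b h :
  sharp (koszul a b) h = sharp a (sharp b h) - sharp b (sharp a h).
Proof. by rewrite sharp_koszul. Qed.

Definition jacobiator a b c : form1 M :=
  koszul a (koszul b c) + koszul b (koszul c a) + koszul c (koszul a b).

Lemma jacobiator_rot a b c : jacobiator a b c = jacobiator b c a.
Proof. by rewrite /jacobiator addrC addrA addrC addrA. Qed.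

Lemma jacobiatorE a b c :
  jacobiator a b c = koszul a (koszul b c) - koszul b (koszul a c) - koszul (koszul a b) c.
Proof.
by rewrite /jacobiator (koszulC c a) koszulNr (koszulC c (koszul a b)).
Qed.

Lemma koszul2_linr a b h c c' : koszul a (koszul b (f1_scale h c + c')) =
  f1_scale h (koszul a (koszul b c)) + (f1_scale (sharp a h) (koszul b c) +
  (f1_scale (sharp b h) (koszul a c) + (f1_scale (sharp a (sharp b h)) c +
  koszul a (koszul b c')))).
Proof. by rewrite koszul_linr [LHS]koszul_linr koszul_linr. Qed.

(** First derivatives of [h] cancel in pairs; the second-order terms cancel because [sharp] respects
    brackets ([sharp_koszul_f]). *)
Lemma jacobiator_lin a b h c c' : jacobiator a b (f1_scale h c + c') =
  f1_scale h (jacobiator a b c) + jacobiator a b c'.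
Proof.
rewrite !jacobiatorE 2!koszul2_linr koszul_linr sharp_koszul_f.
move: (koszul a (koszul b c)) (koszul a (koszul b c')) (koszul b (koszul a c))
  (koszul b (koszul a c')) (koszul (koszul a b) c) (koszul (koszul a b) c')
  (koszul b c) (koszul a c) => k1 k2 k3 k4 k5 k6 k7 k8.
move: (sharp a h) (sharp b h) (sharp a (sharp b h)) (sharp b (sharp a h)) => s1 s2 s3 s4.
by apply: form1P => X; rewrite !(form1DE, form1NE, f1_scaleE); ring.
Qed.

Lemma jacobiator_exact f g h : jacobiator (diff0 f) (diff0 g) (diff0 h) = 0.
Proof.
rewrite /jacobiator !koszul_exact -!diff0D.
have := poisson_jacobi pi f g h; rewrite /poisson_br => ->.
by apply: form1P => X; rewrite diff0E vf0.
Qed.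

(** Cyclic symmetry moves each argument in turn to the last slot, where tensoriality reduces it to
    an exact form. *)
Lemma koszul_jacobi a b c : jacobiator a b c = 0.
Proof.
apply: form1P => X; rewrite form10E.
have L x y k z z' : jacobiator x y (f1_scale k z + z') X =
    k * jacobiator x y z X + jacobiator x y z' X.
  by rewrite jacobiator_lin form1DE f1_scaleE.
apply: (vanish_on_exact (Phi := fun c => jacobiator a b c X)) => [*|h]; first exact: L.
rewrite -jacobiator_rot.
apply: (vanish_on_exact (Phi := fun b => jacobiator (diff0 h) a b X)) => [*|g].
  exact: L.
rewrite -jacobiator_rot.
apply: (vanish_on_exact (Phi := fun a => jacobiator (diff0 g) (diff0 h) a X)) => [*|f].
  exact: L.
by rewrite jacobiator_exact.
Qed.

Lemma koszul_lie_bracket : is_lie_bracket koszul.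
Proof.
have lr (k : R) x y z : koszul z (k *: x + y) = k *: koszul z x + koszul z y.
  rewrite !f1_scaler_cst koszul_linr vf_cst; congr (_ + _).
  by apply: form1P => X; rewrite form1DE f1_scaleE mul0r add0r.
split=> [k x y z|//|x|]; [|exact: koszulXX|exact: koszul_jacobi].
by rewrite koszulC lr opprD -scalerN -!koszulC.
Qed.

Lemma lie1_diff0 Z f : lie1 Z (diff0 f) = diff0 (Z f).
Proof. by apply: form1P => X; rewrite lie1E !diff0E vf_bracketE; ring. Qed.

Lemma lie1_bracket X Y a :
  lie1 (vf_bracket X Y) a = lie1 X (lie1 Y a) - lie1 Y (lie1 X a).
Proof.
apply: form1P => Z; rewrite form1DE form1NE !lie1E !vfD !vfN vf_bracketE.
have -> : vf_bracket (vf_bracket X Y) Z =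
    vf_bracket X (vf_bracket Y Z) - vf_bracket Y (vf_bracket X Z).
  by rewrite (vf_bracket_jacobi X Y Z) addrK.
by rewrite form1D form1N; ring.
Qed.

Lemma diff1_lie1 Z a : diff1 (lie1 Z a) = lie2 Z (diff1 a).
Proof.
apply: form2P => X Y; rewrite lie2E !Defs.diff1E !lie1E (vf_bracket_jacobi Z X Y).
by rewrite !vf_bracketE form1D !(vfD, vfN); ring.
Qed.

(** Cartan's magic formula for [dw = 0], with [form2r w Z] the contraction of [w] by [Z]. *)
Lemma lie2_closed_form Z (w : cform2 M) : lie2 Z w = diff1 (form2r w Z).
Proof.
have /asboolP cw := cform2P w.
apply: form2P => X Y; rewrite lie2E Defs.diff1E.
have := cw Z X Y; rewrite /diff2 /= => E.
rewrite (form2C w X (vf_bracket Z Y)).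
apply/eqP; rewrite -subr_eq0 -[X in _ == X]E (form2C w (vf_bracket X Y) Z); apply/eqP.
by ring.
Qed.

End Anchor.

(** * The Lie algebra [g_pi], its ideal and the exact sequence *)

Section PicardSequence.
Variables (R : realType) (n : nat) (M : manifold R n) (pi : poissonStructure M).
Local Notation C := (smoothFun M).
Local Notation sharp := (sharp pi).
Local Notation koszul := (koszul_br pi).
Implicit Types (f g h : C) (a b eta : form1 M) (X Y Z : vectorField M).

Lemma form2DE (w w' : form2 M) X Y : (w + w') X Y = w X Y + w' X Y. Proof. by []. Qed.
Lemma form20E X Y : (0 : form2 M) X Y = 0. Proof. by []. Qed.

Lemma diff1_scalar_lin (k : R) a b : diff1 (k *: a + b) = k *: diff1 a + diff1 b.
Proof.
apply: form2P => X Y; rewrite form2DE.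
have -> : (k *: diff1 a) X Y = k *: diff1 a X Y by [].
rewrite !Defs.diff1E !form1DE !form1ZE !(vfD, vfZ) !smooth_scaleE.
by ring.
Qed.

Lemma diff1B a b : diff1 (a - b) = diff1 a - diff1 b.
Proof. by rewrite addrC -scaleN1r diff1_scalar_lin scaleN1r addrC. Qed.

Lemma diff1_diff0 f : diff1 (diff0 f) = 0.
Proof.
by apply: form2P => X Y; rewrite Defs.diff1E !diff0E vf_bracketE form20E; ring.
Qed.

Lemma diff1_koszul a b : diff1 (koszul a b) =
  lie2 (sharp a) (diff1 b) - lie2 (sharp b) (diff1 a).
Proof. by rewrite /koszul_br 2!diff1B diff1_diff0 subr0 !diff1_lie1. Qed.

Lemma anchor_diff_koszul a b : anchor_diff pi (koszul a b) =
  semidirect_br (anchor_diff pi a) (anchor_diff pi b).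
Proof.
congr (_, _); first exact: sharp_koszul.
by apply: val_inj; exact: diff1_koszul.
Qed.

Lemma sharp_scalar_lin (k : R) a b : sharp (k *: a + b) = k *: sharp a + sharp b.
Proof. by rewrite f1_scaler_cst sharp_lin vf_scaler_cst. Qed.

Lemma anchor_diff_lin (k : R) a b : anchor_diff pi (k *: a + b) =
  k *: anchor_diff pi a + anchor_diff pi b.
Proof.
congr (_, _); first exact: sharp_scalar_lin.
by apply: val_inj; exact: diff1_scalar_lin.
Qed.

(** With # for [sharp], [sharp_koszul] and skewness turn [a([#eta, #b])] into [- [eta, b](#a)];
    expanding that Koszul bracket produces the terms of [d eta (#a, #b)]. *)
Lemma lie_biv_sharp eta : lie_biv pi (sharp eta) = sharp2 pi (diff1 eta).
Proof.
apply/funext => a; apply/funext => b; rewrite /lie_biv /sharp2 Defs.diff1E.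
have E1 : pi a (lie1 (sharp eta) b) =
    sharp eta (pi a b) - b (vf_bracket (sharp eta) (sharp a)).
  by rewrite -sharpP lie1E sharpP.
have E2 : pi (lie1 (sharp eta) a) b =
    - (sharp eta (pi b a) - a (vf_bracket (sharp eta) (sharp b))).
  by rewrite bivC -sharpP lie1E sharpP.
have E3 : a (vf_bracket (sharp eta) (sharp b)) = - koszul eta b (sharp a).
  by rewrite -sharp_koszul !sharpP bivC.
rewrite E1 E2 E3 koszulE !sharpP (bivC pi eta b) (vf_bracketC (sharp b)) form1N.
by rewrite (bivC pi b a) !vfN; ring.
Qed.

Lemma g_pi_anchor eta : g_pi pi (anchor_diff pi eta).
Proof. exact: lie_biv_sharp. Qed.

Lemma anchor_diff0P eta : closed_basic pi eta <-> anchor_diff pi eta = 0.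
Proof.
split=> [[ceta beta]|E].
  congr (_, _); last by apply: val_inj; exact: ceta.
  apply: vectorFieldP => f; rewrite sharpE bivC -sharpP.
  by rewrite (beta f).1 oppr0.
have s0 : sharp eta = 0 by have := congr1 fst E.
have d0 : diff1 eta = 0 by have := congr1 (fun u => cform2_val u.2) E.
have h0 f : eta (ham pi f) = 0.
  by rewrite sharpP bivC -sharpE s0 oppr0.
split=> // f; split=> //; apply: form1P => X.
have := congr1 (fun w : form2 M => w (ham pi f) X) d0.
rewrite Defs.diff1E h0 vf0 subr0 form20E.
by rewrite lie1E.
Qed.

(** Closed basic forms are the kernel of [anchor_diff], which is linear and respects brackets. *)
Lemma closed_basic_subalgebra (hO : is_lie_bracket koszul) :
  @lie_subalgebra R (Omega1 hO) (closed_basic pi).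
Proof.
split; [split|].
- by apply/anchor_diff0P; have := anchor_diff_lin (- 1) 0 0;
    rewrite scaler0 addr0 => ->; rewrite scaleN1r addNr.
- move=> k a b /anchor_diff0P a0 /anchor_diff0P b0.
  by apply/anchor_diff0P; rewrite anchor_diff_lin a0 b0 scaler0 addr0.
move=> a b /anchor_diff0P a0 /anchor_diff0P b0; apply/anchor_diff0P.
rewrite [lie_br _ _]/(koszul a b) anchor_diff_koszul a0 b0.
exact: (lie_alt (semidirect_brP M) 0).
Qed.

(** Evaluate [L_Z pi = pi^#(w)] on the pair [a], [df] and use [L_Z df = d(Z f)]. *)
Lemma bracket_sharp Z (w : cform2 M) a : lie_biv pi Z = sharp2 pi w ->
  vf_bracket Z (sharp a) = sharp (lie1 Z a - form2r w (sharp a)).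
Proof.
move=> Zw; apply: vectorFieldP => f; rewrite vf_bracketE !sharpE bivDl bivNl.
have := congr1 (fun T => T a (diff0 f)) Zw; rewrite /lie_biv /sharp2 lie1_diff0 => E.
rewrite (bivC pi (form2r w (sharp a))) -(sharpP pi (diff0 f)) opprK.
have -> : form2r w (sharp a) (sharp (diff0 f)) = _ := esym E.
by ring.
Qed.

Lemma lie_biv_lin (k : R) Y Z a b :
  lie_biv pi (k *: Y + Z) a b = k *: lie_biv pi Y a b + lie_biv pi Z a b.
Proof.
have L c : lie1 (k *: Y + Z) c = f1_scale (smooth_cst M k) (lie1 Y c) + lie1 Z c.
  apply: form1P => X; rewrite form1DE f1_scaleE !lie1E vf_bracket_linl.
  by rewrite !vf_scaler_cst form1_lin vfDE vf_scaleE; ring.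
rewrite /lie_biv !L biv_linl biv_linr vfDE vfZE !smooth_scaleE.
by ring.
Qed.

Lemma g_pi_expand Z (w : cform2 M) a b : lie_biv pi Z = sharp2 pi w ->
  Z (pi a b) = w (sharp a) (sharp b) + pi (lie1 Z a) b + pi a (lie1 Z b).
Proof.
move=> /(congr1 (fun T => T a b)); rewrite /lie_biv /sharp2 => <-.
by ring.
Qed.

(** Derivatives of [pi] are expanded twice by [g_pi_expand], and brackets with [sharp] are removed
    by [bracket_sharp]; what remains is algebraic. *)
Lemma g_pi_bracket (u v : semidirect M) : g_pi pi u -> g_pi pi v ->
  g_pi pi (semidirect_br u v).
Proof.
case: u v => [Y w] [Z t] /= Yw Zt; rewrite /g_pi /= in Yw Zt *.
apply/funext => a; apply/funext => b; rewrite /sharp2 /lie_biv !lie1_bracket.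
rewrite !bivDl !bivDr !bivNl !bivNr vf_bracketE.
rewrite (g_pi_expand a b Zt) (g_pi_expand a b Yw) !vfD.
rewrite !(g_pi_expand _ _ Zt) !(g_pi_expand _ _ Yw).
have -> : (lie2c Y t - lie2c Z w) (sharp a) (sharp b) =
    lie2c Y t (sharp a) (sharp b) - lie2c Z w (sharp a) (sharp b) by [].
rewrite !lie2cE !(bracket_sharp _ Yw) !(bracket_sharp _ Zt) !sharpD !sharpN.
rewrite !form2Dl !form2Dr !form2Nl !form2Nr.
(* Terms containing both 2-forms become [pi] of two contractions, and they cancel by skewness of
   [pi]. *)
have r (s s' : cform2 M) x y : s (sharp x) (sharp (form2r s' (sharp y))) =
    pi (form2r s' (sharp y)) (form2r s (sharp x)).
  by rewrite -sharpP.
have l (s s' : cform2 M) x y : s (sharp (form2r s' (sharp y))) (sharp x) =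
    - pi (form2r s' (sharp y)) (form2r s (sharp x)).
  by rewrite form2C r.
rewrite !l !r.
rewrite (bivC pi (form2r t (sharp a)) (form2r w (sharp b))).
rewrite (bivC pi (form2r w (sharp a)) (form2r t (sharp b))).
by ring.
Qed.

Lemma g_pi_subalgebra : @lie_subalgebra R (semidirect M) (g_pi pi).
Proof.
split; [split|exact: g_pi_bracket].
  have := g_pi_anchor 0; rewrite (_ : anchor_diff pi 0 = 0)//.
  have := anchor_diff_lin (- 1) 0 0.
  by rewrite scaler0 addr0 => ->; rewrite scaleN1r addNr.
move=> k u v; rewrite /g_pi /= => gu gv.
apply/funext => a; apply/funext => b.
by rewrite [LHS](lie_biv_lin k u.1 v.1 a b) gu gv.
Qed.

(** The vector field part is [bracket_sharp]; the form part holds because [d] commutes with [L_Z]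
    and [L_X w = d(i_X w)] for the closed form [w]. *)
Lemma semidirect_br_anchor (u : semidirect M) eta : g_pi pi u ->
  semidirect_br u (anchor_diff pi eta) =
  anchor_diff pi (lie1 u.1 eta - form2r u.2 (sharp eta)).
Proof.
move=> gu; congr (_, _) => /=; first exact: bracket_sharp.
have E : lie2 u.1 (diff1 eta) - lie2 (sharp eta) u.2 =
    diff1 (lie1 u.1 eta - form2r u.2 (sharp eta)).
  by rewrite diff1B diff1_lie1 lie2_closed_form.
by apply: val_inj; exact: E.
Qed.

Lemma pic_ideal_ideal (hG : lie_subalgebra (g_pi pi)) :
  @lie_ideal R (g_lie hG) (pic_ideal hG).
Proof.
split; [split|].
- by exists 0; have := anchor_diff_lin (- 1) 0 0;
    rewrite scaler0 addr0 => ->; rewrite scaleN1r addNr.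
- move=> k x y [a xa] [b yb]; exists (k *: a + b).
  by rewrite anchor_diff_lin -xa -yb.
move=> x y [eta yeta].
exists (lie1 (sub_lie_val x).1 eta - form2r (sub_lie_val x).2 (sharp eta)).
rewrite -semidirect_br_anchor -?yeta//.
by have /asboolP := sub_lie_valP x.
Qed.

End PicardSequence.

Theorem theorem1p2 (R : realType) (n : nat) (M : manifold R n)
    (pi : poissonStructure M) :
  exists (hO : is_lie_bracket (koszul_br pi))
         (hB : @lie_subalgebra R (Omega1 hO) (closed_basic pi))
         (hG : @lie_subalgebra R (semidirect M) (g_pi pi))
         (hA : forall eta, g_pi pi (anchor_diff pi eta))
         (hI : @lie_ideal R (g_lie hG) (pic_ideal hG)),
    @lie_exact R (Omega1_clbas hB) (Omega1 hO) (g_lie hG) (pic hI)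
      (@clbas_incl R n M pi hO hB)
      (@Omega1_to_g R n M pi hO hG hA)
      (@pic_proj R n M pi hG hI).
Proof.
exists (koszul_lie_bracket pi), (closed_basic_subalgebra _), (g_pi_subalgebra pi),
  (g_pi_anchor pi), (pic_ideal_ideal _).
split; split.
- by split.
- split=> [k x y|x y]; apply: val_inj; first exact: anchor_diff_lin.
  exact: anchor_diff_koszul.
- split=> [k x y|x y]; last by rewrite [RHS]quot_lie_brE.
  by rewrite /pic_proj quot_lie_projD quot_lie_projZ.
- exact: val_inj.
(* Exactness at the 1-forms is [anchor_diff0P], read in both directions. *)
- apply/seteqP; split=> [_ [x _ <-]|x /= x0].
    apply: val_inj; apply/anchor_diff0P.
    by have /asboolP := sub_lie_valP x.
  have cx : closed_basic pi x.
    by apply/anchor_diff0P; exact: (congr1 (@sub_lie_val _ _ _ _) x0).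
  by exists (SubLie (asboolT cx : x \in sub_lie_pred (closed_basic_subalgebra _))).
(* Writing the zero class as the class of 0 turns the kernel of the projection into [pic_ideal],
   which is by definition the image of the 1-forms. *)
- have p0 : quot_lie_proj (pic_ideal_ideal (g_pi_subalgebra pi)) 0 = 0 by exact: raddf0.
  apply/seteqP; split=> [_ [eta _ <-]|u /=].
    by rewrite /= -p0; apply/quot_lie_projP; rewrite subr0; exists eta.
  rewrite -p0 => /quot_lie_projP; rewrite subr0 => -[eta ueta].
  by exists eta => //; apply: val_inj.
by apply/seteqP; split=> // x _; exists (repr x) => //; exact: quot_lie_projK.
Qed.
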